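(* Let $M$ be a loopless oriented matroid of rank $d$ on a finite ground set $E$. The three filtrations $\mathcal Q_\bullet(M)$ (Quillen), $\mathcal K_\bullet(M)$ (Kalinin) and $\overline{\mathcal P}_\bullet(M)$ (mod $2$ reduction of the dual Varchenko--Gelfand degree filtration) of the $\mathbb Z/2\mathbb Z$-tope space $(\mathbb Z/2\mathbb Z)[\mathcal T(M)]$ coincide, i.e. $\mathcal Q_p(M)=\mathcal K_p(M)=\overline{\mathcal P}_p(M)$ for every $0\le p\le d$.
   Context: **Oriented matroids.** $M$ has underlying matroid $\underline M$ and covector set $\mathcal L\subseteq\{0,+,-\}^E$, ordered coordinatewise by $0<+$, $0<-$ (with $+,-$ incomparable). Composition: $(L\circ K)_e=L_e$ if $L_e\ne0$ and $K_e$ otherwise. The topes are the maximal covectors; as $M$ is loopless, $\mathcal T=\mathcal T(M)\subseteq\{+,-\}^E$. The flats of $\underline M$ are the sets $E\setminus\mathrm{supp}(L)$, $L\in\mathcal L$. For $T\in\mathcal T$ and $F\subseteq E$, $T\setminus F$ is obtained from $T$ by setting the coordinates in $F$ to $0$. For $\mathbf v\in(\mathbb Z/2\mathbb Z)^E$, $T_{\mathbf v}\in\{+,-\}^E$ is given by $(T_{\mathbf v})_e=(-1)^{\mathbf v_e}$; this identifies $\{+,-\}^E$ with $(\mathbb Z/2\mathbb Z)^E$. For a commutative ring $R$, the $R$-tope space is the free module $R[\mathcal T]$ on $\mathcal T$. **Dual Varchenko--Gelfand filtration.** $\mathbb Z[\mathcal T]^*$ is the ring of linear functions $\mathbb Z[\mathcal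 T]\to\mathbb Z$, with multiplication defined pointwise on topes. For $e\in E$ the Heaviside function $h_e$ is the linear function with $h_e(T)=1$ if $T_e=+$ and $h_e(T)=0$ if $T_e=-$. The $h_e$ and the unit generate this ring. The degree of a nonzero $f$ is the minimal degree of a polynomial in the $h_e$ representing $f$; the zero function has degree $-1$. $\mathcal P^p(M)$ is the set of functions of degree at most $p$. $\mathcal P_p(M)=\{\gamma\in\mathbb Z[\mathcal T]: f(\gamma)=0\ \forall f\in\mathcal P^{p-1}(M)\}$. $\overline{\mathcal P}_p(M)$ is the image of $\mathcal P_p(M)$ in $(\mathbb Z/2\mathbb Z)[\mathcal T]$ under reduction mod $2$. **Salvetti complex.** The fine Salvetti complex is the order complex of the poset $\{w(L,T):L\in\mathcal L,T\in\mathcal T,L\le T\}$, where $w(L,T)\le w(L',T')$ iff $L'\le L$ and $T=L\circ T'$. For $L\le T$, let $Z(L,T)$ be its restriction to the vertices $w(L',L'\circ T)$, $L'\ge L$; it is a ball of dimension $\dim L:=\mathrm{rank}(E\setminus\mathrm{supp}(L))$ with boundary $\bigcup_{L'>L}Z(L',L'\circ T)$. The balls $Z(L,T)$ are the cells of a regular CW structure, the Salvetti complex $\mathrm{Sal}_M$. For arbitrary $L\in\mathcal L,T\in\mathcal T$ put $Z(L,T):=Z(L,L\circ T)$. The vertices $Z(T,T)$ correspond bijectively to the topes. The conjugation is the cellular involution $\overline{Z(L,T)}=Z(L,-T)$; its fixed locus is the set of vertices. $C_i(\mathrm{Sal}_M;\mathbb Z/2\mathbb Z)$ denotes cellular chains,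 and $i_*:(\mathbb Z/2\mathbb Z)[\mathcal T]\to C_0(\mathrm{Sal}_M;\mathbb Z/2\mathbb Z)$ is $T\mapsto Z(T,T)$. **Kalinin filtration.** $\mathcal K_0(M)=(\mathbb Z/2\mathbb Z)[\mathcal T]$. For $p\ge1$, $\gamma\in\mathcal K_p(M)$ iff there are chains $\beta_i\in C_i(\mathrm{Sal}_M;\mathbb Z/2\mathbb Z)$, $1\le i\le p$, with $\partial\beta_1=i_*\gamma$ and $\partial\beta_i=\beta_{i-1}+\overline{\beta_{i-1}}$ for $2\le i\le p$. **Quillen filtration.** For a finite-dimensional $\mathbb Z/2\mathbb Z$-vector space $V$, let $\mathcal I_0(V)=(\mathbb Z/2\mathbb Z)[V]$ be the group algebra (basis $T_{\mathbf v}$, $T_{\mathbf v}T_{\mathbf w}=T_{\mathbf v+\mathbf w}$), $\mathcal I_1(V)=\{\sum a_{\mathbf v}T_{\mathbf v}:\sum a_{\mathbf v}=0\}$ its augmentation ideal, and $\mathcal I_p(V)=\mathcal I_1(V)^p$. For a complete flag of flats $\mathcal F:\emptyset=F_0\subsetneq F_1\subsetneq\dots\subsetneq F_d=E$ (rank $F_i=i$), put $\mathcal T_{\mathcal F}=\{T\in\mathcal T:T\setminus F_i\in\mathcal L\ \forall i\}$. It is (known) an affine subspace of $(\mathbb Z/2\mathbb Z)^E$ with direction $V_{\mathcal F}$ spanned by the indicator vectors of $F_1,\dots,F_d$. For any $T_{\mathbf v}\in\mathcal T_{\mathcal F}$ put $\mathcal I_p(\mathcal T_{\mathcal F})=T_{\mathbf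 v}\cdot\mathcal I_p(V_{\mathcal F})\subseteq(\mathbb Z/2\mathbb Z)[\mathcal T_{\mathcal F}]$, which is independent of the choice of $T_{\mathbf v}$. Then $\mathcal Q_p(M)=\sum_{\mathcal F}\mathcal I_p(\mathcal T_{\mathcal F})\subseteq(\mathbb Z/2\mathbb Z)[\mathcal T]$, sum over all complete flags of flats, with $\mathcal Q_0(M)=(\mathbb Z/2\mathbb Z)[\mathcal T]$. *)

(* Defs.v *)
From HB Require Import structures.
From mathcomp Require Import all_boot all_order all_algebra.
From mathcomp Require Import mpoly.

Set Implicit Arguments.
Unset Strict Implicit.
Unset Printing Implicit Defensive.

Import GRing.Theory.
Local Open Scope ring_scope.

(* Signs: [None] is 0, and [Some b] is (-1)^b. *)
Definition sign := option bool.
Notation szero := (None : sign).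
Notation spos := (Some false : sign).
Notation sneg := (Some true : sign).

Definition signvec (E : finType) := {ffun E -> sign}.

Section SignVectors.
Variable E : finType.
Implicit Types (X Y : signvec E) (F : {set E}).

Definition sv0 : signvec E := [ffun=> szero].
Definition sv_opp X : signvec E := [ffun e => omap negb (X e)].
Definition sv_comp X Y : signvec E :=
  [ffun e => if X e != szero then X e else Y e].
Definition sv_le X Y : bool := [forall e, (X e == szero) || (X e == Y e)].
Definition supp X : {set E} := [set e | X e != szero].
Definition sep X Y : {set E} :=
  [set e | (X e != szero) && (Y e == omap negb (X e))].

(* [X] with the coordinates in [F] set to 0, i.e. X \ F. *)
Definition sv_del X F : signvec E :=
  [ffun e => if e \in F then szero else X e].
End SignVectors.

Record oriented_matroid (E : finType) := OrientedMatroid {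
  covectors : {set signvec E};
  covectors0 : sv0 E \in covectors;
  covectorsN : forall X, X \in covectors -> sv_opp X \in covectors;
  covectorsC : forall X Y, X \in covectors -> Y \in covectors ->
    sv_comp X Y \in covectors;
  covectors_elim : forall X Y e, X \in covectors -> Y \in covectors ->
    e \in sep X Y ->
    exists Z, [/\ Z \in covectors, Z e = szero
                & forall f, f \notin sep X Y -> Z f = sv_comp X Y f]
}.

Section UnderlyingMatroid.
Variables (E : finType) (M : oriented_matroid E).
Implicit Types (A I F : {set E}) (e : E).

Definition flat F : bool := [exists L in covectors M, F == ~: supp L].

Definition closure A : {set E} :=
  \bigcap_(F : {set E} | flat F && (A \subset F)) F.

Definition indep I : bool := [forall e in I, e \notin closure (I :\ e)].

Definition rank A : nat :=
  \max_(I : {set E} | (I \subset A) && indep I) #|I|.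

(* The elements of the closure of the empty set are the loops. *)
Definition loopless : bool := closure set0 == set0.

Definition topes : {set signvec E} :=
  [set T in covectors M |
    [forall X in covectors M, sv_le T X ==> (X == T)]].

Definition covector := {L : signvec E | L \in covectors M}.
Definition tope := {T : signvec E | T \in topes}.

(* The free module R[T(M)] on the topes. *)
Definition tope_space (R : nmodType) := {ffun tope -> R}.

End UnderlyingMatroid.


Section TopeLemmas.
Variables (E : finType) (M : oriented_matroid E).

Lemma sv_oppK (X : signvec E) : sv_opp (sv_opp X) = X.
Proof. by apply/ffunP=> e; rewrite !ffunE; case: (X e) => [[]|]. Qed.

Lemma sv_le_comp (X Y : signvec E) : sv_le X (sv_comp X Y).
Proof.
by apply/forallP=> e; rewrite ffunE; case: (X e) => //= b; rewrite eqxx.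
Qed.

Lemma sv_le_oppl (X Y : signvec E) : sv_le (sv_opp X) Y -> sv_le X (sv_opp Y).
Proof.
move=> /forallP h; apply/forallP=> e; move: (h e); rewrite !ffunE.
by case: (X e) => [[]|]; case: (Y e) => [[]|].
Qed.

Lemma tope_opp_proof (T : tope M) : sv_opp (val T) \in topes M.
Proof.
case: T => T /=; rewrite !inE => /andP[TM /forallP Tmax].
rewrite covectorsN //=; apply/forallP=> X; apply/implyP=> XM.
apply/implyP=> /sv_le_oppl le; have := Tmax (sv_opp X).
by rewrite covectorsN // le /= => /eqP <-; rewrite sv_oppK.
Qed.

Lemma tope_comp_proof (L : covector M) (T : tope M) :
  sv_comp (val L) (val T) \in topes M.
Proof.
case: L T => L LM [T] /=; rewrite !inE => /andP[TM /forallP Tmax].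
rewrite covectorsC //=; apply/forallP=> X; apply/implyP=> XM.
apply/implyP=> /forallP le; have := Tmax (sv_comp T X).
rewrite covectorsC // sv_le_comp /= => /eqP/ffunP TX.
apply/eqP/ffunP=> e; move: (TX e) (le e); rewrite !ffunE.
by case: (L e) => [[]|] /=; case: (T e) => [[]|] /=; case: (X e) => [[]|] //=.
Qed.

Definition tope_opp (T : tope M) : tope M :=
  exist (fun X => X \in topes M) _ (tope_opp_proof T).
Definition tope_comp (L : covector M) (T : tope M) : tope M :=
  exist (fun X => X \in topes M) _ (tope_comp_proof L T).

End TopeLemmas.

Section VarchenkoGelfand.
Variables (E : finType) (M : oriented_matroid E).

Definition tope_basis (T : tope M) : tope_space M int :=
  [ffun T' => (T' == T)%:R].

Definition heaviside (e : E) (gamma : tope_space M int) : int :=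
  \sum_(T : tope M) gamma T * (val T e == spos)%:R.

Lemma heaviside_is_additive (e : E) : zmod_morphism (heaviside e).
Proof.
move=> x y; rewrite /heaviside -sumrB; apply: eq_bigr => T _.
by rewrite !ffunE mulrBl.
Qed.

HB.instance Definition _ (e : E) :=
  GRing.isZmodMorphism.Build (tope_space M int) int (heaviside e)
    (heaviside_is_additive e).

(* Multiplication in Z[T(M)]^* is pointwise on topes, so [q] evaluated at the
   Heaviside functions equals [f] iff it does so at each tope. *)
Definition represents (q : {mpoly int[#|E|]})
    (f : {additive tope_space M int -> int}) : Prop :=
  forall T : tope M,
    f (tope_basis T) = q.@[fun i => heaviside (enum_val i) (tope_basis T)].

(* The filtration step P^(p-1): [msize q] is the degree of [q] plus one, and it
   is 0 for [q = 0], so that P^(-1) = 0. *)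
Definition vg_pred (p : nat) (f : {additive tope_space M int -> int}) : Prop :=
  exists2 q : {mpoly int[#|E|]}, (msize q <= p)%N & represents q f.

Definition dual_vg (p : nat) (gamma : tope_space M int) : Prop :=
  forall f : {additive tope_space M int -> int}, vg_pred p f -> f gamma = 0.

Definition dual_vg_mod2 (p : nat) (gamma : tope_space M 'F_2) : Prop :=
  exists2 g : tope_space M int, dual_vg p g & gamma = [ffun T => (g T)%:~R].

End VarchenkoGelfand.

Section Salvetti.
Variables (E : finType) (M : oriented_matroid E).

(* The pairs L <= T, indexing both the vertices w(L,T) of the fine Salvetti
   complex and the cells Z(L,T) of the Salvetti complex. *)
Definition salvetti_index :=
  {c : covector M * tope M | sv_le (val c.1) (val c.2)}.

Definition cov_of (c : salvetti_index) : covector M := (val c).1.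
Definition tope_of (c : salvetti_index) : tope M := (val c).2.

Lemma mk_index_proof (L : covector M) (T : tope M) :
  sv_le (val (L, tope_comp L T).1) (val (L, tope_comp L T).2).
Proof. exact: sv_le_comp. Qed.

(* The index (L, L o T). *)
Definition mk_index (L : covector M) (T : tope M) : salvetti_index :=
  exist (fun c => sv_le (val c.1) (val c.2)) _ (mk_index_proof L T).

Definition fine_le (w w' : salvetti_index) : bool :=
  sv_le (val (cov_of w')) (val (cov_of w)) &&
  (tope_of w == tope_comp (cov_of w) (tope_of w')).

(* The simplices of the order complex. *)
Definition fine_simplex (s : {set salvetti_index}) : bool :=
  (s != set0) && [forall x in s, forall y in s, fine_le x y || fine_le y x].

(* Z(L,T), as a set of simplices. *)
Definition ball (c : salvetti_index) : {set {set salvetti_index}} :=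
  [set s | fine_simplex s &
    s \subset [set mk_index L' (tope_of c)
              | L' : covector M & sv_le (val (cov_of c)) (val L')]].

Definition cell_dim (c : salvetti_index) : nat :=
  rank M (~: supp (val (cov_of c))).

(* Chains of all degrees; [in_degree i] singles out C_i. *)
Definition chain := {ffun salvetti_index -> 'F_2}.

Definition in_degree (i : nat) (beta : chain) : Prop :=
  forall c, beta c != 0 -> cell_dim c = i.

Definition facet (c' c : salvetti_index) : bool :=
  (cell_dim c == (cell_dim c').+1) && (ball c' \subset ball c).

(* In a regular CW complex the mod 2 incidence number of two cells of
   consecutive dimensions is 1 if one lies in the other, and 0 otherwise. *)
Definition boundary (beta : chain) : chain :=
  [ffun c' => \sum_(c | facet c' c) beta c].

Definition cell_conj (c : salvetti_index) : salvetti_index :=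
  mk_index (cov_of c) (tope_opp (tope_of c)).

Definition chain_conj (beta : chain) : chain :=
  [ffun c' => \sum_(c | cell_conj c == c') beta c].

(* The cell Z(T,T) is Z(L,T) for the covector L = T. *)
Lemma tope_covector_proof (T : tope M) : val T \in covectors M.
Proof. by have := valP T; rewrite inE => /andP[]. Qed.

Definition vertex (T : tope M) : salvetti_index :=
  mk_index (exist (fun X => X \in covectors M) _ (tope_covector_proof T)) T.

Definition vertex_chain (gamma : tope_space M 'F_2) : chain :=
  [ffun c => \sum_(T | vertex T == c) gamma T].

Definition kalinin (p : nat) (gamma : tope_space M 'F_2) : Prop :=
  if p == 0%N then True else
  exists beta : nat -> chain,
    [/\ forall i, (1 <= i <= p)%N -> in_degree i (beta i),
        boundary (beta 1%N) = vertex_chain gamma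
      & forall i, (2 <= i <= p)%N ->
          boundary (beta i) = beta i.-1 + chain_conj (beta i.-1)].

End Salvetti.

Section GroupAlgebra.
Variable E : finType.

(* ('F_2)^o rather than 'F_2 gives access to the vector space structure. *)
Definition F2vec := {ffun E -> ('F_2)^o}.

(* The group algebra (Z/2)[(Z/2)^E]; that of a subspace V of (Z/2)^E is the
   subalgebra of the elements supported on V. *)
Definition galg := {ffun F2vec -> 'F_2}.

Definition galg_basis (v : F2vec) : galg := [ffun w => (w == v)%:R].

Definition galg_mul (a b : galg) : galg :=
  [ffun w : F2vec => \sum_(v : F2vec) a v * b (w - v)].

Variable V : {vspace F2vec}.

Definition supported (a : galg) : Prop := forall v, a v != 0 -> v \in V.

Definition augmentation_ideal (a : galg) : Prop :=
  supported a /\ \sum_(v : F2vec) a v = 0.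

(* The powers of the augmentation ideal; a product of ideals consists of the
   finite sums of products. *)
Fixpoint aug_power (p : nat) (a : galg) : Prop :=
  if p is p'.+1 then
    exists (n : nat) (x y : 'I_n -> galg),
      [/\ forall k, augmentation_ideal (x k),
          forall k, aug_power p' (y k)
        & a = \sum_(k < n) galg_mul (x k) (y k)]
  else supported a.

End GroupAlgebra.

Section Quillen.
Variables (E : finType) (M : oriented_matroid E).

Let d := rank M [set: E].

Definition flag := {ffun 'I_d.+1 -> {set E}}.

Definition complete_flag (F : flag) : bool :=
  [&& F ord0 == set0, F ord_max == [set: E],
      [forall i, flat M (F i)],
      [forall i, rank M (F i) == i]
    & [forall i : 'I_d.+1, forall j : 'I_d.+1,
         (i < j)%N ==> (F i \proper F j)]].

Definition flag_tope (F : flag) (T : tope M) : bool :=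
  [forall i, sv_del (val T) (F i) \in covectors M].

(* T_v, with coordinates (-1)^(v e). *)
Definition sv_of (v : F2vec E) : signvec E := [ffun e => Some (v e != 0)].

Definition indicator (A : {set E}) : F2vec E := [ffun e => (e \in A)%:R].

Definition flag_space (F : flag) : {vspace F2vec E} :=
  <<[seq indicator (F i) | i : 'I_d.+1]>>%VS.

(* The identification of T with v for T = T_v, extended linearly. *)
Definition to_galg (gamma : tope_space M 'F_2) : galg E :=
  [ffun v => \sum_(T : tope M | val T == sv_of v) gamma T].

Definition flag_power (F : flag) (p : nat) (gamma : tope_space M 'F_2) : Prop :=
  exists (T : tope M) (v : F2vec E) (a : galg E),
    [/\ flag_tope F T, val T = sv_of v, aug_power (flag_space F) p a
      & to_galg gamma = galg_mul (galg_basis v) a].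

Definition quillen (p : nat) (gamma : tope_space M 'F_2) : Prop :=
  if p == 0%N then True else
  exists2 g : flag -> tope_space M 'F_2,
    forall F, complete_flag F -> flag_power F p (g F)
    & gamma = \sum_(F | complete_flag F) g F.

End Quillen.

(* Main.v *)
(* A cube is obtained from a tope of a contraction M/e_1/.../e_p by reflecting
   successively in e_p, ..., e_1; it is an (alternating) sum of 2^p topes. Write
   R_p for the span of the cubes mod 2, and P'_p for the annihilator in
   (Z/2)[T] of the polynomials of degree < p in the Heaviside functions mod 2.
   All three filtrations lie between R_p and P'_p, and P'_p is contained in R_p.

   - P'_p is in R_p by induction on deletion and contraction: cubes lift from M \ e
     to M, and the kernel of (Z/2)[T(M)] -> (Z/2)[T(M \ e)] consists of the images
     of elements of P'_(p-1)(M/e).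
   - A cube is a product of p elements of the augmentation ideal of a flag of
     flats, translated by a tope; and the p-th power of the augmentation ideal of
     any subspace kills the polynomials of degree < p.
   - The alternating sum of a cube annihilates the integral polynomials of degree
     < p, so that R_p consists of reductions of elements of P_p(M).
   - The cells of M/e bound tubes in M, which gives a chain map of degree one
     and raises Kalinin sequences from M/e to M.
   - A Heaviside monomial of degree k < p extends to a sequence of cochains phi_i
     with d phi_i = phi_(i+1) + conj phi_(i+1), vanishing for i > k. Pairing it with
     a Kalinin sequence beta_1, ..., beta_p telescopes to 0. *)

From HB Require Import structures.
From mathcomp Require Import all_boot all_order all_algebra.
From mathcomp Require Import mpoly.
Require Import Defs.

Set Implicit Arguments.
Unset Strict Implicit.
Unset Printing Implicit Defensive.

Import GRing.Theory.
Local Open Scope ring_scope.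

(** The obstacle is lifting: an element of P'_p comes with no integral lift, no chains and no
    decomposition along flags. The cubes carry all three at once: their signs give the lift, their
    tubes the chains, and their successive reflections the flats. Hence everything is routed through
    their span.

    The flag arises because the reflection in e_i, seen in M, negates the whole flat spanned by e_1,
    ..., e_i and not just e_i.

    For the Kalinin filtration, the geometry enters through two facts drawn from covector
    elimination: a covector whose zero set has rank 1 lies below exactly two topes, and an interval
    of length two has exactly two intermediate covectors. Both make sums cancel in pairs mod 2. *)

Notation zeros X := (~: supp X).

(** * Sign vectors and covectors *)

Section SignVectors.
Variable E : finType.
Implicit Types (X Y Z : signvec E) (e f : E).

Lemma in_zeros X e : (e \in zeros X) = (X e == szero).
Proof. by rewrite !inE negbK. Qed.

Lemma zerosP X e : reflect (X e = szero) (e \in zeros X).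
Proof. by rewrite in_zeros; apply: eqP. Qed.

Lemma comp_supp X Y e : X e != szero -> sv_comp X Y e = X e.
Proof. by rewrite ffunE => ->. Qed.

Lemma comp_zero X Y e : X e = szero -> sv_comp X Y e = Y e.
Proof. by move=> h; rewrite ffunE h eqxx. Qed.

Lemma oppE X e : sv_opp X e = omap negb (X e).
Proof. by rewrite ffunE. Qed.

Lemma opp_eq0 X e : (sv_opp X e == szero) = (X e == szero).
Proof. by rewrite oppE; case: (X e). Qed.

Lemma zeros_opp X : zeros (sv_opp X) = zeros X.
Proof. by apply/setP=> e; rewrite !in_zeros opp_eq0. Qed.

Lemma zeros_comp X Y : zeros (sv_comp X Y) = zeros X :&: zeros Y.
Proof.
apply/setP=> e; rewrite in_setI !in_zeros ffunE.
by case: (X e) => [b|] //=; rewrite eqxx.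
Qed.

Lemma compA X Y Z : sv_comp X (sv_comp Y Z) = sv_comp (sv_comp X Y) Z.
Proof. by apply/ffunP=> e; rewrite !ffunE; case: (X e); case: (Y e). Qed.

Lemma opp_comp X Y : sv_opp (sv_comp X Y) = sv_comp (sv_opp X) (sv_opp Y).
Proof. by apply/ffunP=> e; rewrite !ffunE; case: (X e). Qed.

Lemma comp_oppl X Y : sv_comp X (sv_opp (sv_comp X Y)) = sv_comp X (sv_opp Y).
Proof. by apply/ffunP=> e; rewrite !ffunE; case: (X e). Qed.

Lemma sv_leP X Y :
  reflect (forall e, X e != szero -> Y e = X e) (sv_le X Y).
Proof.
apply: (iffP forallP) => h e; first by move: (h e); case: eqP => //= _ /eqP.
by case: eqP => //= /eqP /h ->.
Qed.

Lemma sv_le_comp_eq X Y : sv_le X Y = (sv_comp X Y == Y).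
Proof.
apply/sv_leP/eqP => [h|h e Xe]; last by rewrite -h comp_supp.
by apply/ffunP=> e; rewrite ffunE; case: ifP => // /h.
Qed.

Lemma le_comp_id X Y : sv_le X Y -> sv_comp X Y = Y.
Proof. by rewrite sv_le_comp_eq => /eqP. Qed.

Lemma sv_le_refl X : sv_le X X. Proof. exact/sv_leP. Qed.

Lemma sv_le_trans : transitive (@sv_le E).
Proof.
move=> Y X Z /sv_leP xy /sv_leP yz; apply/sv_leP=> e Xe.
by rewrite -(xy _ Xe) yz // xy.
Qed.

Lemma le_compr X Y Z : sv_le X Y -> sv_le X (sv_comp Y Z).
Proof. by move=> h; apply: sv_le_trans h (sv_le_comp _ _). Qed.

Lemma comp_absorb X Y Z : sv_le X Y -> sv_comp Y (sv_comp X Z) = sv_comp Y Z.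
Proof.
move=> /sv_leP h; apply/ffunP=> e; rewrite !ffunE.
case: ifP => // /negbFE/eqP Ye; case: eqP => [->|/eqP Xe] //=.
by have eYX := h _ Xe; move: Xe; rewrite -eYX Ye.
Qed.

Lemma comp_tope_absorb X Y : zeros X \subset zeros Y -> sv_comp X Y = X.
Proof.
move=> /subsetP h; apply/ffunP=> e; rewrite ffunE; case: ifP => // /negbFE.
by move=> Xe; move: (h e); rewrite !in_zeros Xe (eqP Xe) => /(_ isT)/eqP.
Qed.

Lemma le_zeros X Y : sv_le X Y -> zeros Y \subset zeros X.
Proof.
move=> /sv_leP h; apply/subsetP=> e; rewrite !in_zeros; apply: contraTT => Xe.
by rewrite h.
Qed.

Lemma le_zeros_eq X Y : sv_le X Y -> zeros X \subset zeros Y -> X = Y.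
Proof. by move=> /le_comp_id {2}<- /comp_tope_absorb ->. Qed.

(** Both are [Z] with the common zero set deleted; so the faces of one covector are told apart by
    their flats. *)
Lemma le_same_zeros X Y Z : sv_le X Z -> sv_le Y Z -> zeros X = zeros Y -> X = Y.
Proof.
move=> /sv_leP xz /sv_leP yz /setP xy; apply/ffunP=> e.
move: (xy e); rewrite !in_zeros; case: (eqVneq (X e)) => [->|/xz <-].
  by move=> /esym/eqP ->.
by move=> /esym/negbT/yz.
Qed.

Lemma sv0_le X : sv_le (sv0 E) X.
Proof. by apply/sv_leP=> e; rewrite ffunE. Qed.

Lemma notin_sepl X Y e : X e = szero -> e \notin sep X Y.
Proof. by move=> h; rewrite inE h. Qed.

Lemma notin_sepr X Y e : Y e = szero -> e \notin sep X Y.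
Proof. by move=> h; rewrite inE h; case: (X e). Qed.

Lemma notin_sepe X Y e : X e = Y e -> e \notin sep X Y.
Proof. by move=> h; rewrite inE h; case: (Y e) => [[]|]. Qed.

Lemma in_sepP X Y e : X e != szero -> Y e != szero -> X e != Y e -> e \in sep X Y.
Proof. by rewrite inE; case: (X e) => [[]|]; case: (Y e) => [[]|]. Qed.

Lemma le_of_sep X Y :
  zeros Y \subset zeros X -> sep X Y = set0 -> sv_le X Y.
Proof.
move=> /subsetP zYX /setP h; apply/sv_leP=> e; move: (h e) (zYX e).
rewrite !inE !negbK; case: (X e) => [[]|] //; case: (Y e) => [[]|] //= _;
  by move/(_ isT).
Qed.

End SignVectors.

Section Covectors.
Variables (E : finType) (M : oriented_matroid E).
Implicit Types (X Y Z L T : signvec E) (e f g : E) (A B F I J : {set E}).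

Lemma topeP T :
  reflect (T \in covectors M /\ forall X, X \in covectors M -> sv_comp T X = T)
          (T \in topes M).
Proof.
rewrite inE; apply: (iffP andP) => [[TM /forallP h]|[TM h]]; split=> //.
  by move=> X XM; move: (h (sv_comp T X)); rewrite covectorsC // sv_le_comp => /eqP.
apply/forallP=> X; apply/implyP=> XM; apply/implyP=> /le_comp_id; rewrite h //.
by move->.
Qed.

Lemma tope_cov T : T \in topes M -> T \in covectors M.
Proof. by case/topeP. Qed.

(** With loops allowed, the zero set of a tope is the set of loops. This lemma and its converse
    [tope_zerosP] stand in for topes being full sign vectors. *)
Lemma tope_zeros_sub T X : T \in topes M -> X \in covectors M ->
  zeros T \subset zeros X.
Proof.
case/topeP=> _ h /h TX; rewrite -TX zeros_comp; exact: subsetIr.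
Qed.

Lemma tope_zerosP T : T \in covectors M ->
  (forall X, X \in covectors M -> zeros T \subset zeros X) -> T \in topes M.
Proof.
by move=> TM h; apply/topeP; split=> // X /h; apply: comp_tope_absorb.
Qed.

Lemma tope_ex X : X \in covectors M -> exists2 T, T \in topes M & sv_le X T.
Proof.
move=> XM; pose P T := (T \in covectors M) && sv_le X T.
have PX : P X by rewrite /P XM sv_le_refl.
case: (@arg_maxnP _ X P (fun T => #|supp T|) PX) => T /andP[TM le_XT] maxT.
exists T => //; apply: tope_zerosP => // Y YM; rewrite setCS.
have := maxT (sv_comp T Y); rewrite /P covectorsC // le_compr // => /(_ isT).
move=> le; have sub : supp T \subset supp (sv_comp T Y).
  by rewrite -setCS zeros_comp subsetIl.
have /eqP eq : supp T == supp (sv_comp T Y) by rewrite eqEcard sub.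
rewrite eq -setCS zeros_comp; exact: subsetIr.
Qed.

(** The three clauses describe the coordinates outside the separation set; where [X] and [Y] are
    non-zero and opposite, only the value at [e] is known. *)
Lemma eliminate X Y e : X \in covectors M -> Y \in covectors M ->
    X e != szero -> Y e != szero -> X e != Y e ->
  exists Z, [/\ Z \in covectors M, Z e = szero,
    (forall f, X f = szero -> Z f = Y f), (forall f, Y f = szero -> Z f = X f)
    & forall f, X f = Y f -> Z f = X f].
Proof.
move=> XM YM Xe Ye ne; have [Z [ZM Ze Zf]] :=
  covectors_elim XM YM (in_sepP Xe Ye ne).
exists Z; split=> // f h.
- by rewrite Zf ?notin_sepl // comp_zero.
- by rewrite Zf ?notin_sepr // ffunE; case: eqP => //= ->.
- by rewrite Zf ?notin_sepe // ffunE -h; case: ifP.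
Qed.

Lemma flat_zeros L : L \in covectors M -> flat M (zeros L).
Proof. by move=> LM; apply/existsP; exists L; rewrite LM eqxx. Qed.

Lemma flatP F : reflect (exists2 L, L \in covectors M & F = zeros L) (flat M F).
Proof.
apply: (iffP existsP) => [[L /andP[LM /eqP]]|[L LM ->]]; first by exists L.
by exists L; rewrite LM eqxx.
Qed.

Lemma closureP A e :
  reflect (forall X, X \in covectors M -> A \subset zeros X -> X e = szero)
          (e \in closure M A).
Proof.
apply: (iffP bigcapP) => [h X XM AX|h F /andP[/flatP[L LM ->] AF]].
  by apply/zerosP/h; rewrite flat_zeros.
by apply/zerosP/h.
Qed.

Lemma sub_closure A : A \subset closure M A.
Proof. by apply/subsetP=> e eA; apply/closureP=> X _ /subsetP/(_ e eA)/zerosP. Qed.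

Lemma closureS A B : A \subset B -> closure M A \subset closure M B.
Proof.
move=> AB; apply/subsetP=> e /closureP h; apply/closureP=> X XM BX.
by apply: h => //; apply: subset_trans BX.
Qed.

Lemma closure_min A X : X \in covectors M -> A \subset zeros X ->
  closure M A \subset zeros X.
Proof. by move=> XM AX; apply/subsetP=> e /closureP h; apply/zerosP/h. Qed.

Lemma notin_closure A e : e \notin closure M A ->
  exists X, [/\ X \in covectors M, A \subset zeros X & X e != szero].
Proof.
move=> h; have : ~~ [forall X in covectors M, (A \subset zeros X) ==> (X e == szero)].
  apply: contra h => /forallP h; apply/closureP=> X XM AX; apply/eqP.
  by move: (h X); rewrite XM AX.
rewrite negb_forall => /existsP[X]; rewrite !negb_imply => /and3P[XM AX Xe].
by exists X.
Qed.

(** Take [L] of maximal support among the covectors vanishing on [A]. Any other such covector is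
    supported inside [L], since otherwise composing [L] with it would enlarge the support. *)
Lemma closure_flat A : exists2 L, L \in covectors M & closure M A = zeros L.
Proof.
have : exists L, (L \in covectors M) && (A \subset zeros L).
  exists (sv0 E); rewrite covectors0 /=; apply/subsetP=> e _.
  by rewrite in_zeros ffunE.
case/existsP/existsP=> L0 PL0.
case: (@arg_maxnP _ L0 (fun L => (L \in covectors M) && (A \subset zeros L))
  (fun T => #|supp T|) PL0) => L /andP[LM AL] maxL.
exists L => //; apply/eqP; rewrite eqEsubset closure_min //=.
apply/subsetP=> e eL; apply/closureP=> X XM AX.
have := maxL (sv_comp L X); rewrite covectorsC // zeros_comp subsetI AL AX.
move=> /(_ isT) le; have sub : supp L \subset supp (sv_comp L X).
  by rewrite -setCS zeros_comp subsetIl.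
have /eqP eq : supp L == supp (sv_comp L X) by rewrite eqEcard sub.
by apply/zerosP; move: eL; rewrite eq zeros_comp => /setIP[].
Qed.

(** Suppose [X] vanishes at [f] and on [A] but not at [e]. Eliminating [e] between [X], up to sign,
    and a covector [Y] that vanishes on [A] but not at [f] gives a covector vanishing at [e] and on
    [A] but not at [f], a contradiction. *)
Lemma exchange A e f : f \in closure M (e |: A) -> f \notin closure M A ->
  e \in closure M (f |: A).
Proof.
move=> fe /notin_closure[Y [YM AY Yf]]; apply/closureP=> X XM.
rewrite subUset sub1set => /andP[/zerosP Xf AX]; apply/eqP; apply/negPn/negP=> Xe.
have Ye : Y e != szero.
  apply: contraNneq Yf => Ye; apply/eqP; move/closureP: fe; apply=> //.
  by rewrite subUset sub1set AY andbT; apply/zerosP.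
wlog ne : X XM Xf AX Xe / X e != Y e.
  move=> wl; case: (eqVneq (X e) (Y e)) => [eq|]; last exact: wl.
  apply: (wl (sv_opp X)); rewrite ?opp_eq0 ?zeros_opp ?covectorsN //.
    by rewrite oppE Xf.
  by rewrite oppE eq; case: (Y e) Ye => [[]|].
have [Z [ZM Ze ZY ZX _]] := eliminate XM YM Xe Ye ne.
move/closureP: fe => /(_ Z ZM); rewrite ZY // => h; case/eqP: Yf; apply: h.
rewrite subUset sub1set; apply/andP; split; first exact/zerosP.
apply/subsetP=> g gA; apply/zerosP; rewrite ZY; apply/zerosP.
  exact: (subsetP AY).
exact: (subsetP AX).
Qed.

End Covectors.

(* Minors keep the ground set E: contracted and deleted elements become loops.
   This is why loops are allowed below although the theorem excludes them. *)
Section Minors.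
Variables (E : finType).
Implicit Types (M : oriented_matroid E) (X Y Z L T : signvec E) (e f g : E).
Implicit Types (C : {set signvec E}) (A F I J : {set E}).

Definition ctr C e := [set X in C | X e == szero].
Definition sv_zap e X := sv_del X [set e].
Definition del C e := [set sv_zap e X | X in C].

Lemma zapE e X f : sv_zap e X f = if f == e then szero else X f.
Proof. by rewrite ffunE inE. Qed.

Lemma in_ctr C e X : (X \in ctr C e) = (X \in C) && (X e == szero).
Proof. by rewrite inE. Qed.

Lemma ctr_sub C e X : X \in ctr C e -> X \in C.
Proof. by rewrite in_ctr => /andP[]. Qed.

Lemma ctr_zero C e X : X \in ctr C e -> X e = szero.
Proof. by rewrite in_ctr => /andP[_ /eqP]. Qed.

Lemma ctr0 M e : sv0 E \in ctr (covectors M) e.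
Proof. by rewrite in_ctr covectors0 ffunE eqxx. Qed.

Lemma ctrN M e X : X \in ctr (covectors M) e -> sv_opp X \in ctr (covectors M) e.
Proof. by rewrite !in_ctr opp_eq0 => /andP[/covectorsN -> ->]. Qed.

Lemma ctrC M e X Y : X \in ctr (covectors M) e -> Y \in ctr (covectors M) e ->
  sv_comp X Y \in ctr (covectors M) e.
Proof.
rewrite !in_ctr => /andP[XM /eqP Xe] /andP[YM /eqP Ye].
by rewrite covectorsC // comp_zero // Ye eqxx.
Qed.

Lemma ctr_elim M e X Y f :
    X \in ctr (covectors M) e -> Y \in ctr (covectors M) e -> f \in sep X Y ->
  exists Z, [/\ Z \in ctr (covectors M) e, Z f = szero
              & forall g, g \notin sep X Y -> Z g = sv_comp X Y g].
Proof.
rewrite !in_ctr => /andP[XM /eqP Xe] /andP[YM /eqP Ye] fS.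
have [Z [ZM Zf Zg]] := covectors_elim XM YM fS.
by exists Z; split; rewrite ?in_ctr ?ZM // Zg ?notin_sepl // comp_zero // Ye eqxx.
Qed.

Definition contract M e : oriented_matroid E :=
  OrientedMatroid (ctr0 M e) (@ctrN M e) (@ctrC M e) (@ctr_elim M e).

Lemma delP C e X :
  reflect (exists2 X', X' \in C & X = sv_zap e X') (X \in del C e).
Proof. exact: imsetP. Qed.

Lemma mem_del C e X : X \in C -> sv_zap e X \in del C e.
Proof. exact: imset_f. Qed.

Lemma zap_comp e X Y : sv_zap e (sv_comp X Y) = sv_comp (sv_zap e X) (sv_zap e Y).
Proof.
by apply/ffunP=> f; rewrite !ffunE inE; case: (f =P e) => // _; rewrite eqxx.
Qed.

Lemma zap_opp e X : sv_zap e (sv_opp X) = sv_opp (sv_zap e X).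
Proof. by apply/ffunP=> f; rewrite !ffunE inE; case: (f =P e). Qed.

Lemma del0 M e : sv0 E \in del (covectors M) e.
Proof.
apply/delP; exists (sv0 E); first exact: covectors0.
by apply/ffunP=> f; rewrite zapE !ffunE if_same.
Qed.

Lemma delN M e X : X \in del (covectors M) e -> sv_opp X \in del (covectors M) e.
Proof. by case/delP=> X' XM ->; rewrite -zap_opp mem_del ?covectorsN. Qed.

Lemma delC M e X Y : X \in del (covectors M) e -> Y \in del (covectors M) e ->
  sv_comp X Y \in del (covectors M) e.
Proof.
by case/delP=> X' XM -> /delP[Y' YM ->]; rewrite -zap_comp mem_del ?covectorsC.
Qed.

Lemma del_elim M e X Y f :
    X \in del (covectors M) e -> Y \in del (covectors M) e -> f \in sep X Y ->
  exists Z, [/\ Z \in del (covectors M) e, Z f = szero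
              & forall g, g \notin sep X Y -> Z g = sv_comp X Y g].
Proof.
case/delP=> X' XM -> /delP[Y' YM ->] fS.
have sepE g : g \in sep (sv_zap e X') (sv_zap e Y') =
              (g != e) && (g \in sep X' Y').
  by rewrite !inE !zapE; case: (g =P e).
have := fS; rewrite sepE => /andP[fe fS'].
have [Z [ZM Zf Zg]] := covectors_elim XM YM fS'.
exists (sv_zap e Z); split; first exact: mem_del.
  by rewrite zapE (negbTE fe).
move=> g; rewrite sepE -zap_comp !zapE; case: (g =P e) => //= _; exact: Zg.
Qed.

Definition delete M e : oriented_matroid E :=
  OrientedMatroid (del0 M e) (@delN M e) (@delC M e) (@del_elim M e).

(** Serves the lifting of cubes, where each contraction is moved past the deletion. It compares sets
    because the two oriented matroids also carry proof fields. *)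
Lemma ctr_del C e f : e != f -> ctr (del C f) e = del (ctr C e) f.
Proof.
move=> ef; apply/setP=> X; rewrite in_ctr; apply/andP/delP.
  case=> /delP[X' X'C ->]; rewrite zapE (negbTE ef) => X'e.
  by exists X' => //; rewrite in_ctr X'C.
case=> X'; rewrite in_ctr => /andP[X'C X'e] ->; rewrite mem_del //.
by rewrite zapE (negbTE ef).
Qed.

End Minors.

(** * Ranks of flats, by contraction of non-loops *)

Section Rank.
Variable E : finType.
Implicit Types (M : oriented_matroid E) (X Y Z L T : signvec E) (e f g : E).
Implicit Types (A B F I J : {set E}).

Lemma closure_contract M e A : closure (contract M e) A = closure M (e |: A).
Proof.
apply/setP=> f; apply/closureP/closureP => h X.
  move=> XM; rewrite subUset sub1set => /andP[/zerosP Xe]; apply: h.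
  by rewrite in_ctr XM Xe eqxx.
rewrite in_ctr => /andP[XM Xe] AX; apply: h => //.
by rewrite subUset sub1set AX andbT in_zeros.
Qed.

Lemma indepP M I :
  reflect (forall e, e \in I -> e \notin closure M (I :\ e)) (indep M I).
Proof.
apply: (iffP forallP) => h e; first by move/implyP: (h e).
by apply/implyP/h.
Qed.

(* Removing from I a suitable element f frees any non-loop e in its closure. *)
Lemma closure_support M e I : e \notin closure M set0 -> e \in closure M I ->
  exists2 f, f \in I & forall J, I :\ f \subset J ->
    f \in closure M (e |: J).
Proof.
move=> e0 eI.
have [J /minsetP[eJ minJ] JI] := @minset_exists _ (fun J => e \in closure M J) _ eI.
have [f fJ] : exists f, f \in J.
  by apply/set0Pn; apply: contraNneq e0 => J0; rewrite -J0.
exists f; first exact: (subsetP JI).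
move=> K IK.
have sub : e |: J :\ f \subset e |: K.
  by apply: setUS; apply: subset_trans IK; apply: setSD.
apply: (subsetP (closureS _ sub)); apply: exchange; first by rewrite setD1K.
apply/negP=> h; have := minJ _ h (subD1set _ _) => eq.
by move: fJ; rewrite -eq !inE eqxx.
Qed.

Lemma closureU1_id M e A : e \in closure M A -> closure M (e |: A) = closure M A.
Proof.
move=> eA; apply/eqP; rewrite eqEsubset [X in _ && X]closureS ?subsetUr // andbT.
have [L LM eL] := closure_flat M A; rewrite eL; apply: closure_min => //.
by rewrite -eL subUset sub1set eA sub_closure.
Qed.

Lemma indep_contract M e I : e \notin closure M set0 ->
  indep (contract M e) I -> e \notin I /\ indep M (e |: I).
Proof.
move=> e0 /indepP iI.
have eI : e \notin I.
  apply/negP=> eI; move: (iI _ eI); rewrite closure_contract.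
  by rewrite (subsetP (sub_closure _ _)) // !inE eqxx.
split=> //; apply/indepP=> f; rewrite !inE => /predU1P[->|fI].
  rewrite setU1K //; apply/negP=> ecl.
  have [g gI] := closure_support e0 ecl.
  move=> /(_ (I :\ g) (subxx _)) h; have := iI _ gI.
  by rewrite closure_contract h.
have := iI _ fI; rewrite closure_contract.
suff -> : (e |: I) :\ f = e |: I :\ f by [].
rewrite setDUl; congr (_ :|: _); apply/setP=> g; rewrite !inE.
by case: (g =P f) => //= ->; apply: esym; apply: contraNF eI => /eqP <-.
Qed.

(** If [e] depends on [J], one element has to be given up: [closure_support] finds one whose removal
    frees [e], and by exchange the others remain independent modulo [e]. *)
Lemma contract_indep M e J : e \notin closure M set0 -> indep M J ->
  exists I, [/\ I \subset J, indep (contract M e) I & #|J| <= #|I|.+1]%N.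
Proof.
move=> e0 /indepP iJ; case: (boolP (e \in closure M J)) => eJ; last first.
  exists J; split=> //; apply/indepP=> g gJ; rewrite closure_contract.
  apply: contra eJ => h; have := exchange h (iJ _ gJ).
  by rewrite setD1K.
have [f fJ hf] := closure_support e0 eJ.
exists (J :\ f); split; rewrite ?subD1set ?(cardsD1 f J) ?fJ //.
have eJf : e \notin closure M (J :\ f).
  apply/negP=> h; have := iJ _ fJ.
  by rewrite -(closureU1_id h) hf.
apply/indepP=> g; rewrite in_setD1 => /andP[gf gJ]; rewrite closure_contract.
apply: contra eJf => h.
have gN : g \notin closure M (J :\ f :\ g).
  apply: contra (iJ _ gJ); apply/subsetP/closureS.
  by rewrite setDDl setUC -setDDl subD1set.
have := exchange h gN; rewrite setD1K // !inE gf; exact.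
Qed.

(** With [rank_loops] this makes rank a recursion: the facts below on ranks of flats contract
    non-loops until only loops remain. *)
Lemma rank_contract M e A : e \in A -> e \notin closure M set0 ->
  rank M A = (rank (contract M e) A).+1.
Proof.
move=> eA e0; apply/eqP; rewrite eqn_leq; apply/andP; split.
  apply/bigmax_leqP=> J /andP[JA iJ].
  have [I [IJ iI le]] := contract_indep e0 iJ; apply: leq_trans le _.
  rewrite ltnS; apply: (@bigmax_sup _ I); rewrite ?iI ?andbT //.
  exact: subset_trans JA.
rewrite /rank; have : (0 < #|[pred I : {set E} | (I \subset A) && indep (contract M e) I]|)%N.
  apply/card_gt0P; exists set0; rewrite inE sub0set; apply/indepP=> f.
  by rewrite inE.
case/(eq_bigmax_cond (fun I : {set E} => #|I|)) => I; rewrite inE.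
move=> /andP[IA iI] ->; have [eI iI'] := indep_contract e0 iI.
apply: (@bigmax_sup _ (e |: I)); last by rewrite cardsU1 eI.
by rewrite iI' subUset sub1set eA IA.
Qed.

Lemma rank_loops M A : A \subset closure M set0 -> rank M A = 0%N.
Proof.
move=> Al; apply/eqP; rewrite -leqn0; apply/bigmax_leqP=> I /andP[IA /indepP iI].
rewrite leqn0 cards_eq0; apply/negPn/negP=> /set0Pn[e eI].
have := iI _ eI; rewrite (subsetP (closureS _ (sub0set _))) //.
by apply: (subsetP Al); apply: (subsetP IA).
Qed.

Lemma rank_tope M T : T \in topes M -> rank M (zeros T) = 0%N.
Proof.
move=> TM; apply: rank_loops; apply/subsetP=> e eT; apply/closureP=> X XM _.
by apply/zerosP; apply: (subsetP (tope_zeros_sub TM XM)).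
Qed.

Lemma nonloopP M e :
  reflect (exists2 X, X \in covectors M & X e != szero) (e \notin closure M set0).
Proof.
apply: (iffP idP) => [/notin_closure[X [XM _ Xe]]|[X XM Xe]]; first by exists X.
by apply: contraNN Xe => /closureP/(_ X XM (sub0set _)) ->.
Qed.

(** Contracting the non-loops of [zeros X] one at a time lowers both ranks equally. At the end
    [zeros X] has rank 0, while an element of [zeros L] outside it is a non-loop, as [X] itself
    shows. *)
Lemma rank_zeros_lt M L X : L \in covectors M -> X \in covectors M ->
  zeros X \proper zeros L -> (rank M (zeros X) < rank M (zeros L))%N.
Proof.
have [n] := ubnP #|zeros X :\: closure M set0|.
elim: n M => // n IH M le LM XM pXL.
case: (set_0Vmem (zeros X :\: closure M set0)) => [|[e]].
  move/eqP; rewrite setD_eq0 => /rank_loops ->.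
  case/properP: pXL => _ [f fL]; rewrite in_zeros => Xf.
  by rewrite (@rank_contract _ f) //; apply/nonloopP; exists X.
rewrite inE => /andP[e0 eX].
have eL : e \in zeros L by apply: (subsetP (proper_sub pXL)).
rewrite (@rank_contract M e (zeros X)) // (@rank_contract M e (zeros L)) // ltnS; apply: IH => //.
- move: le; rewrite ltnS (cardsD1 e) in_setD e0 eX; apply: leq_trans.
  rewrite ltnS; apply: subset_leq_card; rewrite setDDl; apply: setDS.
  rewrite closure_contract subUset closureS ?sub0set //= sub1set.
  by rewrite (subsetP (sub_closure _ _)) // !inE eqxx.
- by rewrite in_ctr LM -in_zeros.
- by rewrite in_ctr XM -in_zeros.
Qed.

(** The same induction; once [zeros X] consists of loops, contracting [e] turns the whole closure
    into loops. *)
Lemma rank_closureU1 M X e : X \in covectors M -> X e != szero ->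
  rank M (closure M (e |: zeros X)) = (rank M (zeros X)).+1.
Proof.
have [n] := ubnP #|zeros X :\: closure M set0|.
elim: n M => // n IH M le XM Xe.
case: (set_0Vmem (zeros X :\: closure M set0)) => [|[f]].
  move/eqP; rewrite setD_eq0 => Xl; rewrite (rank_loops Xl).
  rewrite (@rank_contract _ e); last by apply/nonloopP; exists X.
    rewrite rank_loops // closure_contract setU0.
    have [L LM eL] := closure_flat M [set e].
    rewrite eL; apply: closure_min => //; rewrite subUset -eL sub_closure.
    by apply: subset_trans Xl _; apply: closureS; apply: sub0set.
  by apply: (subsetP (sub_closure _ _)); rewrite !inE eqxx.
rewrite inE => /andP[f0 fX].
rewrite (@rank_contract M f (zeros X)) // (@rank_contract M f) //; last first.
  by apply: (subsetP (sub_closure _ _)); rewrite inE fX orbT.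
congr _.+1; rewrite -IH //; last by rewrite in_ctr XM -in_zeros.
  rewrite closure_contract setUCA; congr (rank _ (closure _ (_ |: _))).
  by symmetry; apply/setUidPr; rewrite sub1set.
move: le; rewrite ltnS (cardsD1 f) in_setD f0 fX; apply: leq_trans.
rewrite ltnS; apply: subset_leq_card; rewrite setDDl; apply: setDS.
rewrite closure_contract subUset closureS ?sub0set //= sub1set.
by rewrite (subsetP (sub_closure _ _)) // !inE eqxx.
Qed.

Lemma rank0_tope M L : L \in covectors M -> rank M (zeros L) = 0%N -> L \in topes M.
Proof.
move=> LM r0; apply: tope_zerosP => // X XM; apply/negPn/negP=> nsub.
have ne : zeros (sv_comp L X) \proper zeros L.
  by rewrite zeros_comp properE subsetIl subsetI subxx.
by have := rank_zeros_lt LM (covectorsC LM XM) ne; rewrite r0.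
Qed.

End Rank.

(** * The diamond property of the covector poset *)

Section Intervals.
Variables (E : finType) (M : oriented_matroid E).
Implicit Types (X Y Z L K T : signvec E) (e f g : E).

Lemma le_zeros_proper L X : sv_le L X -> L != X -> zeros X \proper zeros L.
Proof.
move=> le ne; rewrite properEneq le_zeros // andbT; apply: contraNneq ne => eq.
by apply/eqP/le_zeros_eq; rewrite ?eq.
Qed.

Lemma rank_lt L X : L \in covectors M -> X \in covectors M ->
  sv_le L X -> L != X -> (rank M (zeros X) < rank M (zeros L))%N.
Proof. by move=> LM XM le ne; apply: rank_zeros_lt (le_zeros_proper le ne). Qed.

(* Repeatedly eliminating an element separating Y from K pushes Y below K. *)
Lemma ray L K Y : K \in covectors M -> Y \in covectors M ->
    sv_le L K -> sv_le L Y ->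
    zeros K \proper zeros Y -> zeros Y \proper zeros L ->
  exists2 Z, [/\ Z \in covectors M, sv_le L Z, sv_le Z K, Z != L & Z != K] &
    forall f, Y f = K f \/ Y f = szero /\ ~~ sv_le Y K -> Z f = K f.
Proof.
move=> KM; have [n] := ubnP #|sep Y K|.
elim: n Y => // n IH Y le_n YM LK LY KY YL.
have zKY := subsetP (proper_sub KY).
have LE f : L f != szero -> Y f = K f.
  by move=> Lf; rewrite (sv_leP _ _ LY) // (sv_leP _ _ LK).
case: (set_0Vmem (sep Y K)) => [s0|[e eS]].
  have YK : sv_le Y K by apply: le_of_sep s0; apply: proper_sub.
  exists Y; last by move=> f [] // []; rewrite YK.
  split=> //; first by apply: contraTneq YL => ->; rewrite properxx.
  by apply: contraTneq KY => ->; rewrite properxx.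
have /andP[Ye Ke] : (Y e != szero) && (K e != szero).
  by move: eS; rewrite inE; case: (Y e) => [b|] //= /eqP ->.
have ne : Y e != K e.
  by move: eS; rewrite inE => /andP[_ /eqP ->]; case: (Y e) Ye => [[]|].
have [Z [ZM Ze ZK ZY Zs]] := eliminate YM KM Ye Ke ne.
have YK0 : ~~ sv_le Y K by apply: contra ne => /sv_leP ->.
have Zf f : Y f = K f \/ Y f = szero /\ ~~ sv_le Y K -> Z f = K f.
  by case=> [h|[h _]]; [rewrite Zs ?h // |rewrite ZK].
have [f fY /negP fK] : exists2 f, f \in zeros Y & ~ f \in zeros K.
  by case/properP: KY => _ [f ? /negP ?]; exists f.
have fZ : Z f = K f by apply: ZK; apply/zerosP.
have LZ : sv_le L Z.
  by apply/sv_leP=> h Lh; rewrite Zs ?LE // (sv_leP _ _ LK).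
have KZ : zeros K \proper zeros Z.
  apply/properP; split.
    by apply/subsetP=> h hK; apply/zerosP; rewrite ZY; apply/zerosP => //; apply: zKY.
  by exists e; [apply/zerosP | apply/zerosP/eqP].
have ZL : zeros Z \proper zeros L.
  rewrite le_zeros_proper //; apply: contraTneq fY => LZe; apply: contra fK.
  move=> fY; apply/zerosP; rewrite -fZ -LZe; apply/zerosP.
  exact: (subsetP (proper_sub YL)).
have sepZ : (#|sep Z K| < n)%N.
  move: le_n; rewrite ltnS; apply: leq_trans; apply: proper_card.
  apply/properP; split; last by exists e; rewrite // notin_sepl.
  apply/subsetP=> h; apply: contraTT => hS.
  case: (eqVneq (Y h) szero) => [/ZK/notin_sepe //|Yh].
  case: (eqVneq (K h) szero) => [/notin_sepr //|Kh].
  apply: notin_sepe; apply: Zf; left; apply/eqP/negPn; apply: contra hS.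
  exact: in_sepP.
have [Z' h' hZ'] := IH Z sepZ ZM LK LZ KZ ZL.
by exists Z' => // h /Zf eq; apply: hZ'; left.
Qed.

(** Let [W] have as zero set the flat spanned by [zeros K] and one more element of [zeros L]. Then L
    o W lies above [L] with a flat of the right size, though perhaps not below [K]; [ray] moves it
    there. *)
Lemma cover_between L K : L \in covectors M -> K \in covectors M ->
    sv_le L K -> ((rank M (zeros K)).+1 < rank M (zeros L))%N ->
  exists Z, [/\ Z \in covectors M, sv_le L Z, sv_le Z K, Z != L & Z != K].
Proof.
move=> LM KM LK lt.
have ne : L != K by apply: contraTneq lt => ->; rewrite ltnNge leqnSn.
have /properP[sub [e eL]] := le_zeros_proper LK ne; rewrite in_zeros => eK.
have [W WM eW] := closure_flat M (e |: zeros K).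
have rW := rank_closureU1 KM eK; rewrite eW in rW.
have WL : zeros W \subset zeros L.
  by rewrite -eW; apply: closure_min; rewrite // subUset sub1set eL.
have eqW : zeros (sv_comp L W) = zeros W.
  by rewrite zeros_comp; apply/setIidPr.
have [||Z ? _] := @ray L K (sv_comp L W) KM (covectorsC LM WM) LK (sv_le_comp _ _).
- rewrite eqW; apply/properP; split.
    by rewrite -eW (subset_trans _ (sub_closure _ _)) // subsetUr.
  exists e; last by rewrite in_zeros.
  by rewrite -eW (subsetP (sub_closure _ _)) // !inE eqxx.
- rewrite eqW properEneq WL andbT; apply: contraTneq lt => <-.
  by rewrite rW ltnn.
- by exists Z.
Qed.

Lemma lower_cover K : K \in covectors M -> K != sv0 E ->
  exists L, [/\ L \in covectors M, sv_le L K
              & rank M (zeros L) = (rank M (zeros K)).+1].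
Proof.
move=> KM K0; pose P L := [&& L \in covectors M, sv_le L K & L != K].
have P0 : P (sv0 E) by rewrite /P covectors0 sv0_le eq_sym.
case: (@arg_minnP _ _ P (fun L => rank M (zeros L)) P0) => L /and3P[LM LK ne] minL.
exists L; split=> //; apply/eqP; rewrite eqn_leq rank_lt // andbT leqNgt.
apply/negP=> /(cover_between LM KM LK)[Z [ZM LZ ZK ZL ZneK]].
have := minL Z; rewrite /P ZM ZK ZneK => /(_ isT); rewrite leqNgt.
by rewrite rank_lt // eq_sym.
Qed.

(** If [X] and [Y] differ at [g] but agree at some [f] outside the support of [L], where they are
    non-zero, then eliminating [g] gives a covector strictly above [L]. It has rank 0, so it is a
    tope, yet it vanishes at the non-loop [g]. *)
Lemma edge_tope L X Y : L \in covectors M -> rank M (zeros L) = 1%N ->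
    X \in topes M -> Y \in topes M -> sv_le L X -> sv_le L Y ->
  Y = X \/ Y = sv_comp L (sv_opp X).
Proof.
move=> LM r1 XT YT LX LY; have XM := tope_cov XT; have YM := tope_cov YT.
have zXY : zeros X = zeros Y by apply/eqP; rewrite eqEsubset !(@tope_zeros_sub _ M).
have XY f : (X f == szero) = (Y f == szero) by rewrite -!in_zeros zXY.
case: (eqVneq Y X) => [|ne]; [by left|right].
have [g gne] : exists g, X g != Y g.
  apply/existsP; apply: contraNT ne; rewrite negb_exists => /forallP h.
  by apply/eqP/ffunP=> f; apply/esym/eqP; move: (h f); rewrite negbK.
have Xg : X g != szero.
  by apply: contraNneq gne => h; rewrite h eq_sym -XY h.
have Lg : L g = szero.
  apply/eqP; apply: contraNT gne => Lg.
  by rewrite (sv_leP _ _ LX) // (sv_leP _ _ LY).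
apply/ffunP=> f; case: (eqVneq (L f) szero) => Lf; last first.
  by rewrite comp_supp // (sv_leP _ _ LY).
rewrite comp_zero // oppE; case: (eqVneq (X f) szero) => Xf.
  by rewrite Xf; apply/eqP; rewrite -XY Xf.
apply/eqP/negPn/negP => h.
have XYf : X f = Y f.
  by move: h Xf (XY f); case: (X f) => [[]|]; case: (Y f) => [[]|].
have Yg : Y g != szero by rewrite -XY.
have [Z [ZM Zg _ _ Zs]] := eliminate XM YM Xg Yg gne.
have LZ : sv_le L Z.
  by apply/sv_leP=> k Lk; rewrite Zs (sv_leP _ _ LX) // (sv_leP _ _ LY).
have ZL : L != Z.
  by apply: contraTneq Xf => LZe; rewrite -Zs // -LZe Lf.
have := rank_lt LM ZM LZ ZL; rewrite r1 ltnS leqn0 => /eqP.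
move/(rank0_tope ZM)/tope_zeros_sub => /(_ _ XM)/subsetP/(_ g).
by rewrite !in_zeros Zg => /(_ isT); rewrite (negbTE Xg).
Qed.

(** The interval behaves like a sector in rank two: the covector [K] is bounded by two rays. A third
    ray would produce two nested distinct flats of the same rank. *)
Lemma diamond L K : L \in covectors M -> K \in covectors M ->
    sv_le L K -> rank M (zeros L) = (rank M (zeros K)).+2 ->
  exists X1 X2, X1 != X2 /\
    [set X in covectors M | [&& sv_le L X, sv_le X K &
       rank M (zeros X) == (rank M (zeros K)).+1]] = [set X1; X2].
Proof.
move=> LM KM LK rL; set S := [set X in _ | _].
have rankS X : X \in covectors M -> zeros K \proper zeros X ->
    zeros X \proper zeros L -> rank M (zeros X) = (rank M (zeros K)).+1.
  move=> XM /(rank_zeros_lt XM KM) lt1 /(rank_zeros_lt LM XM).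
  by rewrite rL ltnS => lt2; apply/eqP; rewrite eqn_leq lt2.
have inS X : X \in S -> [/\ X \in covectors M, sv_le L X, sv_le X K,
     zeros K \proper zeros X & zeros X \proper zeros L].
  rewrite inE => /and4P[XM LX XK /eqP rX]; split=> //; apply: le_zeros_proper => //.
    by apply/eqP=> XKe; move: rX; rewrite XKe; apply: n_Sn.
  by apply/eqP=> LXe; move: rL; rewrite LXe rX => -[]; apply: n_Sn.
have memS X : X \in covectors M -> sv_le L X -> sv_le X K -> X != L -> X != K -> X \in S.
  move=> XM LX XK XL XneK; rewrite inE XM LX XK /=; apply/eqP/rankS => //.
    exact: le_zeros_proper.
  by apply: le_zeros_proper; rewrite // eq_sym.
(* The intermediate flats partition [zeros L] minus [zeros K]: if two of them meet there, their
   intersection, the zero set of X o Y, has the same rank as both and so equals both. *)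
have flatS X Y f : X \in covectors M -> Y \in covectors M ->
    zeros K \proper zeros X -> zeros X \proper zeros L ->
    zeros K \proper zeros Y -> zeros Y \proper zeros L ->
    X f = szero -> Y f = szero -> K f != szero -> zeros X = zeros Y.
  move=> XM YM KX XL KY YL Xf Yf Kf.
  have XYM := covectorsC XM YM.
  have KXY : zeros K \proper zeros (sv_comp X Y).
    rewrite zeros_comp; apply/properP; split; first by rewrite subsetI !proper_sub.
    exists f; last by rewrite in_zeros.
    by rewrite in_setI !in_zeros Xf Yf.
  have XYL : zeros (sv_comp X Y) \proper zeros L.
    by rewrite zeros_comp; apply: sub_proper_trans (subsetIl _ _) XL.
  have rXY := rankS _ XYM KXY XYL.
  have eqZ W : W \in covectors M -> zeros K \proper zeros W ->
      zeros W \proper zeros L -> zeros (sv_comp X Y) \subset zeros W ->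
      zeros (sv_comp X Y) = zeros W.
    move=> WM KW WL sub; apply/eqP; rewrite eqEproper sub /=.
    by apply/negP=> /(rank_zeros_lt WM XYM); rewrite rXY (rankS W) // ltnn.
  have eX := eqZ X XM KX XL; have eY := eqZ Y YM KY YL.
  move: eX eY; rewrite zeros_comp subsetIl subsetIr => eX eY.
  by rewrite -(eX isT); apply: eY.
have ltKL : ((rank M (zeros K)).+1 < rank M (zeros L))%N by rewrite rL.
have [X1 [X1M LX1 X1K X1L X1nK]] := cover_between LM KM LK ltKL.
have X1S := memS _ X1M LX1 X1K X1L X1nK.
have [_ _ _ KX1 X1pL] := inS _ X1S.
have zLX X : sv_le L X -> zeros (sv_comp L (sv_opp X)) = zeros X.
  by move=> LX; rewrite zeros_comp zeros_opp; apply/setIidPr/le_zeros.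
have compL X f : sv_le L X -> sv_le X K -> L f = szero -> X f != szero ->
    sv_comp L (sv_opp X) f = omap negb (K f).
  by move=> LX XK Lf Xf; rewrite comp_zero // oppE (sv_leP _ _ XK).
(* The second ray is found by starting from the opposite of [X1] across [L]. Its extra clause makes
   it non-zero at [f], where [X1] vanishes. *)
have [||X2 [X2M LX2 X2K X2L X2nK] X2E] :=
  @ray L K (sv_comp L (sv_opp X1)) KM (covectorsC LM (covectorsN X1M)) LK (sv_le_comp _ _).
- by rewrite zLX.
- by rewrite zLX.
have X2S := memS _ X2M LX2 X2K X2L X2nK.
have /properP[_ [f fX1]] := KX1; rewrite in_zeros => Kf.
have nle : ~~ sv_le (sv_comp L (sv_opp X1)) K.
  have /properP[_ [g gL]] := X1pL; rewrite in_zeros => Xg.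
  apply/negP=> /sv_leP/(_ g); rewrite (compL X1) ?(sv_leP _ _ X1K) //;
    last exact/zerosP.
  by case: (X1 g) Xg => [[]|] //= _ /(_ isT).
have X2f : X2 f = K f.
  by apply: X2E; right; split=> //; apply/zerosP; rewrite zLX.
exists X1, X2; split.
  by apply: contraTneq fX1 => ->; rewrite in_zeros X2f.
apply/setP=> X; rewrite in_set2; apply/idP/idP; last by case/orP=> /eqP->.
case/inS=> XM LX XK KX XL.
case: (eqVneq X X1) => //= ne1; apply/negPn/negP=> ne2.
have [_ _ _ KX2 X2pL] := inS _ X2S.
have disj Y Z g : Y \in covectors M -> Z \in covectors M ->
    zeros K \proper zeros Y -> zeros Y \proper zeros L ->
    zeros K \proper zeros Z -> zeros Z \proper zeros L ->
    sv_le Y K -> sv_le Z K -> Y != Z ->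
    Y g = szero -> K g != szero -> Z g = K g.
  move=> YM ZM KY YL KZ ZL YK ZK ne Yg Kg.
  rewrite (sv_leP _ _ ZK) //; apply: contraNneq ne => Zg.
  by apply/eqP; apply: le_same_zeros YK ZK _; apply: (@flatS _ _ g).
have /properP[_ [g gX]] := KX; rewrite in_zeros => Kg; move/zerosP in gX.
have /properP[_ [f2 f2X2]] := KX2; rewrite in_zeros => Kf2; move/zerosP in f2X2.
move/zerosP in fX1.
have L0 h Y : zeros Y \proper zeros L -> Y h = szero -> L h = szero.
  by move=> /proper_sub/subsetP/(_ h) hh Yh; apply/zerosP/hh/zerosP.
have Lg := L0 _ _ XL gX; have Lf := L0 _ _ X1pL fX1; have Lf2 := L0 _ _ X2pL f2X2.
have X1g : X1 g = K g by apply: (@disj X).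
have X2g : X2 g = K g by apply: (@disj X) => //.
have Xf : X f = K f by apply: (@disj X1) => //; rewrite eq_sym.
have Xf2 : X f2 = K f2 by apply: (@disj X2) => //; rewrite eq_sym.
have X1f2 : X1 f2 = K f2.
  apply: (@disj X2) => //; apply: contraNneq Kf => eq.
  by rewrite -X2f eq fX1.
(* Eliminating [g] between [X1] and the opposite of [X2] gives [Z] with the same flat as the third
   ray [X], but opposite to [X] at [f] and equal to it at [f2]. *)
set Y := sv_comp L (sv_opp X2).
have YM : Y \in covectors M by rewrite covectorsC ?covectorsN.
have Yneg h : L h = szero -> Y h = omap negb (X2 h) by move=> Lh; rewrite comp_zero // oppE.
have negK (b : sign) : b != szero -> omap negb b != szero /\ omap negb b != b.
  by case: b => [[]|].
have [Z [ZM Zg ZY ZX Zs]] : exists Z, [/\ Z \in covectors M, Z g = szero,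
    (forall f, X1 f = szero -> Z f = Y f), (forall f, Y f = szero -> Z f = X1 f)
    & forall f, X1 f = Y f -> Z f = X1 f].
  apply: eliminate; rewrite ?X1g //; first by rewrite Yneg // X2g; case: (negK _ Kg).
  by rewrite Yneg // X2g eq_sym; case: (negK _ Kg).
have Zf : Z f = omap negb (K f) by rewrite ZY // Yneg // X2f.
have Zf2 : Z f2 = K f2 by rewrite ZX // Yneg // f2X2.
have LZ : sv_le L Z.
  apply/sv_leP=> h Lh; rewrite Zs ?(sv_leP _ _ LX1) //.
  by rewrite comp_supp.
have KZ : zeros K \proper zeros Z.
  apply/properP; split; last by exists g; [apply/zerosP | rewrite in_zeros].
  apply/subsetP=> h hK; apply/zerosP; rewrite ZX; apply/zerosP.
    exact: (subsetP (proper_sub KX1)).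
  rewrite zLX //; exact: (subsetP (proper_sub KX2)).
have ZL : zeros Z \proper zeros L.
  by apply: le_zeros_proper => //; apply: contraTneq Kf2 => LZe; rewrite -Zf2 -LZe Lf2.
have eqXZ : zeros X = zeros Z by apply: (@flatS _ _ g).
(* Eliminating [f] between [X] and [Z] keeps all zeros of [X], adds [f] and stays non-zero at [f2]:
   a flat strictly between [zeros X] and [zeros L], for which there is no rank left. *)
have [V [VM Vf VX VZ Vs]] : exists V, [/\ V \in covectors M, V f = szero,
    (forall f, X f = szero -> V f = Z f), (forall f, Z f = szero -> V f = X f)
    & forall f, X f = Z f -> V f = X f].
  apply: eliminate; rewrite ?Xf ?Zf //; first by case: (negK _ Kf).
  by rewrite eq_sym; case: (negK _ Kf).
have Vf2 : V f2 = K f2 by rewrite Vs // Xf2.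
have zV : zeros X \proper zeros V.
  apply/properP; split; last by exists f; [apply/zerosP | rewrite in_zeros Xf].
  apply/subsetP=> h hX; apply/zerosP; rewrite VX; apply/zerosP => //.
  by rewrite -eqXZ.
have LV : sv_le L V.
  by apply/sv_leP=> h Lh; rewrite Vs ?(sv_leP _ _ LX) // (sv_leP _ _ LZ).
have VL : zeros V \proper zeros L.
  by apply: le_zeros_proper => //; apply: contraTneq Kf2 => LVe; rewrite -Vf2 -LVe Lf2.
have := rank_zeros_lt VM XM zV.
rewrite (rankS X) // (rankS V) ?ltnn //; exact: proper_trans KX zV.
Qed.

End Intervals.

(** * Cubes of topes and the degree filtration *)

Section FreeModules.
Variable R : comNzRingType.
Implicit Types P Q S : finType.

Definition delta P (x : P) : {ffun P -> R} := [ffun y => (y == x)%:R].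

Definition lin P Q (f : P -> {ffun Q -> R}) (g : {ffun P -> R}) : {ffun Q -> R} :=
  [ffun y => \sum_x g x * f x y].

Definition pairing P (m : P -> R) (g : {ffun P -> R}) : R := \sum_x g x * m x.

Lemma deltaE P (x y : P) : delta x y = (y == x)%:R.
Proof. by rewrite ffunE. Qed.

Lemma sum_delta P (x : P) (m : P -> R) : \sum_y delta x y * m y = m x.
Proof.
rewrite (bigD1 x) //= deltaE eqxx mul1r big1 ?addr0 // => y /negbTE ne.
by rewrite deltaE ne mul0r.
Qed.

Lemma lin_delta P Q (f : P -> {ffun Q -> R}) x : lin f (delta x) = f x.
Proof. by apply/ffunP=> y; rewrite ffunE sum_delta. Qed.

Lemma linB P Q (f : P -> {ffun Q -> R}) : {morph lin f : x y / x - y}.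
Proof.
move=> g h; apply/ffunP=> y; rewrite !ffunE -sumrB; apply: eq_bigr => x _.
by rewrite !ffunE mulrBl.
Qed.

Lemma lin0 P Q (f : P -> {ffun Q -> R}) : lin f 0 = 0.
Proof. by rewrite -(subrr 0) linB subrr. Qed.

Lemma linD P Q (f : P -> {ffun Q -> R}) : {morph lin f : x y / x + y}.
Proof. by move=> g h; rewrite -{1}[h]opprK -[- h]sub0r !linB lin0 sub0r opprK. Qed.

Lemma lin_sum P Q (f : P -> {ffun Q -> R}) I (r : seq I) (K : pred I) F :
  lin f (\sum_(i <- r | K i) F i) = \sum_(i <- r | K i) lin f (F i).
Proof. exact: (big_morph (lin f) (linD f) (lin0 f)). Qed.

Lemma lin_comp P Q S (f : P -> {ffun Q -> R}) (h : Q -> {ffun S -> R}) g :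
  lin h (lin f g) = lin (fun x => lin h (f x)) g.
Proof.
apply/ffunP=> z; rewrite !ffunE.
under eq_bigr do rewrite ffunE mulr_suml.
rewrite exchange_big; apply: eq_bigr => x _; rewrite ffunE mulr_sumr.
by apply: eq_bigr => y _; rewrite mulrA.
Qed.

Lemma lin_addf P Q (f f' : P -> {ffun Q -> R}) (g : {ffun P -> R}) :
  lin (fun x => f x + f' x) g = lin f g + lin f' g.
Proof.
apply/ffunP=> y; rewrite !ffunE -big_split; apply: eq_bigr => x _.
by rewrite ffunE mulrDr.
Qed.

Lemma eq_lin P Q (f f' : P -> {ffun Q -> R}) (g : {ffun P -> R}) :
  (forall x, g x != 0 -> f x = f' x) -> lin f g = lin f' g.
Proof.
move=> h; apply/ffunP=> y; rewrite !ffunE; apply: eq_bigr => x _.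
by case: (eqVneq (g x) 0) => [->|/h ->] //; rewrite !mul0r.
Qed.

Lemma lin_id P (g : {ffun P -> R}) : lin (@delta P) g = g.
Proof.
apply/ffunP=> y; rewrite ffunE (bigD1 y) //= deltaE eqxx mulr1 big1 ?addr0 //.
by move=> x ne; rewrite deltaE eq_sym (negbTE ne) mulr0.
Qed.

Lemma lin_neq0 P Q (f : P -> {ffun Q -> R}) (g : {ffun P -> R}) y :
  lin f g y != 0 -> exists2 x, g x != 0 & f x y != 0.
Proof.
rewrite ffunE => ne; have [x] : exists x, g x * f x y != 0.
  apply/existsP; apply: contraNT ne; rewrite negb_exists => /forallP h.
  by rewrite big1 // => x _; apply/eqP; move: (h x); rewrite negbK.
move=> nz; exists x; apply: contraNneq nz => ->; first by rewrite mul0r.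
by rewrite mulr0.
Qed.

Lemma pairing_lin P Q (m : Q -> R) (f : P -> {ffun Q -> R}) g :
  pairing m (lin f g) = pairing (fun x => pairing m (f x)) g.
Proof.
rewrite /pairing; under eq_bigr do rewrite ffunE mulr_suml.
rewrite exchange_big; apply: eq_bigr => x _; rewrite mulr_sumr.
by apply: eq_bigr => y _; rewrite mulrA.
Qed.

Lemma pairing_delta P (m : P -> R) x : pairing m (delta x) = m x.
Proof. exact: sum_delta. Qed.

Lemma pairingB P (m : P -> R) : {morph pairing m : x y / x - y}.
Proof.
move=> g h; rewrite /pairing -sumrB; apply: eq_bigr => x _.
by rewrite !ffunE mulrBl.
Qed.

Lemma pairing0 P (m : P -> R) : pairing m 0 = 0.
Proof. by rewrite -(subrr 0) pairingB subrr. Qed.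

Lemma pairingD P (m : P -> R) : {morph pairing m : x y / x + y}.
Proof.
by move=> g h; rewrite -{1}[h]opprK -[- h]sub0r !pairingB pairing0 sub0r opprK.
Qed.

Lemma pairing_sum P (m : P -> R) I (r : seq I) (K : pred I) F :
  pairing m (\sum_(i <- r | K i) F i) = \sum_(i <- r | K i) pairing m (F i).
Proof. exact: (big_morph (pairing m) (pairingD m) (pairing0 m)). Qed.

Lemma eq_pairing P (m m' : P -> R) (g : {ffun P -> R}) :
  (forall x, g x != 0 -> m x = m' x) -> pairing m g = pairing m' g.
Proof.
move=> h; apply: eq_bigr => x _.
by case: (eqVneq (g x) 0) => [->|/h ->] //; rewrite !mul0r.
Qed.

Lemma pairingZ P (c : R) (m : P -> R) g :
  pairing (fun x => c * m x) g = c * pairing m g.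
Proof. by rewrite /pairing mulr_sumr; apply: eq_bigr => x _; rewrite mulrCA. Qed.

End FreeModules.

Section Cubes.
Variable E : finType.
Implicit Types (M : oriented_matroid E) (X Y Z L T U : signvec E) (e f : E).
Implicit Types (s : seq (E * signvec E)) (t : seq E).

(** When [Y] is non-zero at [e], the two terms are the topes of M on either side of [e] next to the
    tope [U] of M/e. The sign makes the degree argument work over the integers; mod 2 it
    disappears. *)
Definition iota (R : comNzRingType) Y (g : {ffun signvec E -> R}) :=
  lin (fun U => delta R (sv_comp U Y) - delta R (sv_comp U (sv_opp Y))) g.

(* The alternating sum of the topes T o (+-Y_p) o ... o (+-Y_1). *)
Definition cube_vec (R : comNzRingType) s T : {ffun signvec E -> R} :=
  foldr (fun x => @iota R x.2) (delta R T) s.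

(* Each Y_i is a covector of the contraction by e_1, ..., e_(i-1) that does not
   vanish at e_i, and T is a tope of the contraction by e_1, ..., e_p. *)
Fixpoint cube M s T : bool :=
  if s is (e, Y) :: s' then [&& Y \in covectors M, Y e != szero & cube (contract M e) s' T]
  else T \in topes M.

(** Needed because minors formed in different orders have equal covector sets but different proof
    fields. *)
Lemma cube_ext M M' s T : covectors M = covectors M' -> cube M s T = cube M' s T.
Proof.
elim: s M M' => [|[e Y] s IH] M M' eqM /=; first by rewrite /topes eqM.
by rewrite eqM (IH _ (contract M' e)) //= eqM.
Qed.

(** A Heaviside factor is 0 at a zero coordinate as well, so on a minor the monomials involving the
    removed element vanish. *)
Definition monomial (R : comNzRingType) t X : R := \prod_(e <- t) (X e == spos)%:R.

Definition annihilated (R : comNzRingType) p (g : {ffun signvec E -> R}) :=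
  forall t, (size t < p)%N -> pairing (monomial R t) g = 0.

Definition on_topes (R : comNzRingType) M (g : {ffun signvec E -> R}) :=
  forall T, g T != 0 -> T \in topes M.

(** If U o Y vanishes at [f], then [f] is a loop of M/e. A covector [X] non-zero at [f] is therefore
    non-zero at [e], and eliminating [e] between [X] and [Y] gives a covector of M/e that is
    non-zero at [f]. *)
Lemma comp_contract_tope M e Y U : Y \in covectors M -> Y e != szero ->
  U \in topes (contract M e) -> sv_comp U Y \in topes M.
Proof.
move=> YM Ye UT; have /ctr_sub UM := tope_cov UT.
have Ue : U e = szero by apply: ctr_zero (tope_cov UT).
apply: tope_zerosP; first exact: covectorsC.
move=> X XM; apply/subsetP=> f; rewrite zeros_comp => /setIP[/zerosP Uf /zerosP Yf].
have ctr_f Z : Z \in covectors M -> Z e = szero -> Z f = szero.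
  move=> ZM Ze; apply/zerosP; apply: (subsetP (tope_zeros_sub UT _)).
    by rewrite in_ctr ZM Ze eqxx.
  exact/zerosP.
rewrite in_zeros; apply/negPn/negP=> Xf.
have Xe : X e != szero by apply: contraNneq Xf => Xe; rewrite ctr_f.
wlog ne : X XM Xf Xe / X e != Y e.
  move=> wl; case: (eqVneq (X e) (Y e)) => [eq|]; last exact: wl.
  apply: (wl (sv_opp X)); rewrite ?opp_eq0 ?covectorsN //.
  by rewrite oppE eq; case: (Y e) Ye => [[]|].
have [Z [ZM Ze _ ZX _]] := eliminate XM YM Xe Ye ne.
by move: Xf; rewrite -ZX // ctr_f.
Qed.

Lemma on_topes_iota (R : comNzRingType) M e Y (g : {ffun signvec E -> R}) :
  Y \in covectors M -> Y e != szero -> on_topes (contract M e) g ->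
  on_topes M (iota Y g).
Proof.
move=> YM Ye gT T /lin_neq0[U /gT UT]; rewrite !ffunE.
case: (T =P sv_comp U Y) => [-> _|_]; first exact: comp_contract_tope UT.
case: (T =P _) => [->|_]; last by rewrite subr0 eqxx.
by move=> _; apply: comp_contract_tope UT; rewrite ?covectorsN ?opp_eq0.
Qed.

Lemma on_topes_delta (R : comNzRingType) M T : T \in topes M -> on_topes M (delta R T).
Proof.
by move=> TM X; rewrite deltaE; case: (X =P T) => [->|]; rewrite // eqxx.
Qed.

Lemma on_topes_cube (R : comNzRingType) M s T : cube M s T ->
  on_topes M (cube_vec R s T).
Proof.
elim: s M => [|[e Y] s IH] M /=; first exact: on_topes_delta.
by case/and3P=> YM Ye /IH; apply: on_topes_iota.
Qed.

Lemma on_topesD (R : comNzRingType) M (g h : {ffun signvec E -> R}) :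
  on_topes M g -> on_topes M h -> on_topes M (g + h).
Proof.
move=> gT hT T; rewrite ffunE; case: (eqVneq (g T) 0) => [->|/gT //].
by rewrite add0r => /hT.
Qed.

Lemma on_topesN (R : comNzRingType) M (g : {ffun signvec E -> R}) :
  on_topes M g -> on_topes M (- g).
Proof. by move=> gT T; rewrite ffunE oppr_eq0 => /gT. Qed.

Lemma topes_zeros M T U : T \in topes M -> U \in topes M -> zeros T = zeros U.
Proof.
move=> TM UM; apply/eqP.
by rewrite eqEsubset (tope_zeros_sub TM (tope_cov UM)) (tope_zeros_sub UM (tope_cov TM)).
Qed.

Lemma monomial_comp (R : comNzRingType) t X Y :
  monomial R t (sv_comp X Y) =
  monomial R [seq e <- t | e \notin zeros X] X *
  monomial R [seq e <- t | e \in zeros X] Y.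
Proof.
rewrite /monomial !big_filter [LHS](bigID (fun e => e \notin zeros X)) /=.
congr (_ * _); first by apply: eq_bigr => e; rewrite in_zeros => /comp_supp->.
rewrite (eq_bigl (fun e => e \in zeros X)); last by move=> e; rewrite negbK.
by apply: eq_bigr => e /zerosP/comp_zero ->.
Qed.

(** All topes of M/e have the same zeros, so a monomial splits into a part [t0] read off [U] and a
    part [t1] read off [Y] or its opposite. If [t1] is empty the two lifts cancel; otherwise [t0] is
    shorter than the given monomial. *)
Lemma annihilated_iota (R : comNzRingType) M e Y p (g : {ffun signvec E -> R}) :
  Y \in covectors M -> Y e != szero -> on_topes (contract M e) g ->
  annihilated p g -> annihilated p.+1 (iota Y g).
Proof.
move=> YM Ye gT gA t le_t; rewrite pairing_lin.
have [T TM _] := tope_ex (covectors0 (contract M e)).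
pose t0 := [seq e <- t | e \notin zeros T]; pose t1 := [seq e <- t | e \in zeros T].
rewrite (@eq_pairing _ _ _ (fun U =>
  (monomial R t1 Y - monomial R t1 (sv_opp Y)) * monomial R t0 U)); last first.
  move=> U /gT /(topes_zeros TM) eqT.
  by rewrite pairingB !pairing_delta !monomial_comp -eqT -mulrBr mulrC.
rewrite pairingZ; case: (posnP (size t1)) => [/size0nil ->|t1_gt0].
  by rewrite /monomial !big_nil subrr mul0r.
rewrite gA ?mulr0 //; move: le_t; rewrite ltnS; apply: leq_trans.
rewrite -(count_predC (fun e => e \in zeros T) t) -!size_filter -/t1.
by rewrite -[X in (X < _)%N]add0n ltn_add2r.
Qed.

Lemma annihilated_cube (R : comNzRingType) M s T : cube M s T ->
  annihilated (size s) (cube_vec R s T).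
Proof.
elim: s M => [|[e Y] s IH] M //= /and3P[YM Ye sT].
exact: annihilated_iota YM Ye (on_topes_cube sT) (IH _ sT).
Qed.

End Cubes.

(** * Deletion: lifting cubes and the kernel *)

Section Deletion.
Variable E : finType.
Implicit Types (M : oriented_matroid E) (X Y Z L T U : signvec E) (e f : E).
Implicit Types (s : seq (E * signvec E)) (t : seq E).
Variable R : comNzRingType.
Implicit Type g : {ffun signvec E -> R}.

Definition zap_lin e g := lin (fun U => delta R (sv_zap e U)) g.

Lemma zap_linD e : {morph zap_lin e : g h / g + h}.
Proof. exact: linD. Qed.

Lemma zap_linB e : {morph zap_lin e : g h / g - h}.
Proof. exact: linB. Qed.

Lemma tope_zap M e T : T \in topes M -> sv_zap e T \in topes (delete M e).
Proof.
case/topeP=> TM h; apply/topeP; split; first exact: mem_del.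
by move=> _ /delP[X XM ->]; rewrite -zap_comp h.
Qed.

Lemma on_topes_zap M e g : on_topes M g -> on_topes (delete M e) (zap_lin e g).
Proof.
move=> gT T /lin_neq0[U /gT UT]; rewrite deltaE.
by case: (T =P _) => [-> _|]; [apply: tope_zap | rewrite eqxx].
Qed.

Lemma monomial_zero t e X : e \in t -> X e = szero -> monomial R t X = 0.
Proof. by move=> et Xe; rewrite /monomial (big_rem e) //= Xe mul0r. Qed.

Lemma annihilated_zap e p g : annihilated p g -> annihilated p (zap_lin e g).
Proof.
move=> gA t le_t; rewrite pairing_lin.
under eq_pairing => U _ do rewrite pairing_delta.
case: (boolP (e \in t)) => et.
  rewrite (@eq_pairing _ _ _ (fun U => 0 * 0)) ?pairingZ ?mul0r // => U _.
  by rewrite (monomial_zero et) ?mul0r // zapE eqxx.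
rewrite -[RHS](gA t le_t); apply: eq_pairing => U _.
apply: eq_big_seq => f ft; rewrite zapE; case: (f =P e) => // fe.
by rewrite -fe ft in et.
Qed.

Lemma zap_iota e Y g : zap_lin e (iota Y g) = iota (sv_zap e Y) (zap_lin e g).
Proof.
rewrite /zap_lin /iota !lin_comp; apply: eq_lin => U _.
by rewrite linB !lin_delta !zap_comp zap_opp.
Qed.

(** Covectors of the deletion are images of covectors of M, and any tope above a preimage of [T]
    still maps to [T] by maximality. No reflection is in [e], which is a loop of the deletion. *)
Lemma cube_lift M e s T : cube (delete M e) s T ->
  exists s' T', [/\ size s' = size s, cube M s' T'
                  & zap_lin e (cube_vec R s' T') = cube_vec R s T].
Proof.
elim: s M => [|[f Y] s IH] M /=.
  move=> TM; have /delP[X XM eT] := tope_cov TM.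
  have [T' T'M /le_comp_id XT'] := tope_ex XM.
  exists [::], T'; split=> //=; rewrite /zap_lin lin_delta.
  congr (delta R _); rewrite -XT' zap_comp -eT.
  by case/topeP: TM => _; apply; apply/mem_del/tope_cov.
case/and3P=> /delP[Y' Y'M ->] Yf; have fe : f != e.
  by apply: contraNneq Yf => ->; rewrite zapE eqxx.
rewrite (@cube_ext _ _ (delete (contract M f) e)) /=; last exact: ctr_del.
case/IH=> s' [T' [sz sT' eq]]; exists ((f, Y') :: s'), T'.
rewrite /= sz sT' Y'M zap_iota eq; split=> //=; rewrite andbT.
by move: Yf; rewrite zapE (negbTE fe).
Qed.

Lemma card_nonloops_delete M e : e \notin closure M set0 ->
  (#|~: closure (delete M e) set0| < #|~: closure M set0|)%N.
Proof.
move=> e0; apply: proper_card; apply/properP; split; last first.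
  exists e; first by rewrite inE.
  rewrite inE negbK; apply/closureP=> X /delP[X' _ ->] _.
  by rewrite zapE eqxx.
rewrite setCS; apply/subsetP=> f /closureP h; apply/closureP=> X /delP[X' XM ->] _.
by rewrite zapE h ?sub0set // if_same.
Qed.

Lemma card_nonloops_contract M e : e \notin closure M set0 ->
  (#|~: closure (contract M e) set0| < #|~: closure M set0|)%N.
Proof.
move=> e0; rewrite closure_contract; apply: proper_card; apply/properP; split.
  by rewrite setCS; apply/closureS/sub0set.
exists e; rewrite inE // negbK; apply: (subsetP (sub_closure _ _)).
by rewrite !inE eqxx.
Qed.

Definition sv_set e b X : signvec E := [ffun f => if f == e then Some b else X f].

Lemma zap_set e b U : U e = szero -> sv_zap e (sv_set e b U) = U.
Proof.
by move=> Ue; apply/ffunP=> f; rewrite zapE ffunE; case: (f =P e) => // ->.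
Qed.

Lemma set_zap e b T : T e = Some b -> sv_set e b (sv_zap e T) = T.
Proof.
by move=> Te; apply/ffunP=> f; rewrite ffunE zapE; case: (f =P e) => // ->.
Qed.

Lemma zap_id e U : U e = szero -> sv_zap e U = U.
Proof. by move=> Ue; apply/ffunP=> f; rewrite zapE; case: (f =P e) => // ->. Qed.

Lemma zap_linE e g U : U e = szero ->
  zap_lin e g U = g (sv_set e false U) + g (sv_set e true U) + g U.
Proof.
move=> Ue; rewrite ffunE.
have setE b : sv_set e b U e = Some b by rewrite ffunE eqxx.
rewrite (bigD1 (sv_set e false U)) //= (bigD1 (sv_set e true U)) /=; last first.
  by apply/eqP=> /ffunP/(_ e); rewrite !setE.
rewrite (bigD1 U) /=; last first.
  by apply/andP; split; apply/eqP=> /ffunP/(_ e); rewrite setE Ue.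
rewrite !deltaE !zap_set // zap_id // eqxx !mulr1 big1 ?addr0 ?addrA // => T.
case/andP=> /andP[n1 n2] n3; rewrite deltaE; case: (U =P _) => [eq|]; last by rewrite mulr0.
case Te: (T e) => [[]|].
- by rewrite eq set_zap // eqxx in n2.
- by rewrite eq set_zap // eqxx in n1.
- by rewrite eq zap_id // eqxx in n3.
Qed.

(* Topes with the same image in M \ e differ only at e, so that zeroing e gives a
   tope of M/e; multiplying a monomial by h_e then evaluates it on M/e. *)
Lemma zap_kernel M e Y g p : Y \in covectors M -> Y e = spos ->
    on_topes M g -> zap_lin e g = 0 -> annihilated p.+1 g ->
  exists a, [/\ on_topes (contract M e) a, annihilated p a & iota Y a = g].
Proof.
move=> YM Ye gT g0 gA.
have tope_nz T : T \in topes M -> T e != szero.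
  move=> TT; apply: contraTneq isT => /zerosP/(subsetP (tope_zeros_sub TT YM)).
  by rewrite in_zeros Ye.
have gz U : U e = szero -> g U = 0.
  by move=> Ue; apply/eqP; apply: contraTT isT => /gT/tope_nz; rewrite Ue.
(* The fibre over [U] consists of its two lifts and [U] itself, where [g] is 0; so the two lifts
   have opposite coefficients. *)
have gN U : U e = szero -> g (sv_set e true U) = - g (sv_set e false U).
  move=> Ue; apply/eqP; rewrite -addr_eq0 addrC; apply/eqP.
  by rewrite -[LHS]addr0 -{1}(gz _ Ue) -zap_linE // g0 ffunE.
pose a : {ffun signvec E -> R} :=
  [ffun U : signvec E => if U e == szero then g (sv_set e false U) else 0].
have aE U : U e = szero -> a U = g (sv_set e false U) by rewrite ffunE => ->.
have a0 U : a U != 0 -> U e = szero.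
  by rewrite ffunE; case: (U e =P szero) => // _; rewrite eqxx.
have setE b U : sv_set e b U e = Some b by rewrite ffunE eqxx.
have UT U : a U != 0 -> forall b, sv_set e b U \in topes M.
  move=> aU; have Ue := a0 _ aU; move: aU; rewrite aE // => aU [].
    by apply: gT; rewrite gN // oppr_eq0.
  exact: gT.
have aT : on_topes (contract M e) a.
  move=> U aU; have Ue := a0 _ aU.
  have TM b := tope_cov (UT _ aU b).
  (* Both lifts are topes differing only at [e], so eliminating [e] returns [U] itself as a
     covector. *)
  have [|||Z [ZM Ze _ _ Zs]] := eliminate (e := e) (TM true) (TM false); rewrite ?setE //.
  have eZ : Z = U.
    apply/ffunP=> f; case: (eqVneq f e) => [->|fe]; first by rewrite Ze Ue.
    by rewrite Zs ffunE (negbTE fe) // ffunE (negbTE fe).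
  apply/topeP; split; first by rewrite in_ctr -eZ ZM Ze eqxx.
  move=> X XM; have /topeP[_ /(_ X (ctr_sub XM)) /(congr1 (sv_zap e))] := UT _ aU true.
  by rewrite zap_comp zap_set // zap_id // (ctr_zero XM).
exists a; split=> //.
  move=> t le_t; case: (boolP (e \in t)) => et.
    rewrite (@eq_pairing _ _ _ (fun U => 0 * 0)) ?pairingZ ?mul0r // => U aU.
    by rewrite (monomial_zero et) ?mul0r // a0.
  rewrite -[RHS](gA (e :: t) le_t).
  rewrite /pairing (bigID (fun U : signvec E => U e == szero)) /=.
  rewrite [X in _ + X]big1 ?addr0; last first.
    by move=> U Ue; rewrite ffunE (negbTE Ue) mul0r.
  rewrite [RHS](bigID (fun U : signvec E => U e == spos)) /=.
  rewrite [X in _ = _ + X]big1 ?addr0; last first.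
    by move=> U Ue; rewrite /monomial big_cons (negbTE Ue) mul0r mulr0.
  rewrite [RHS](reindex_onto (sv_set e false) (sv_zap e)) /=; last first.
    by move=> U /eqP Ue; rewrite set_zap.
  apply: eq_big => [U|U /eqP Ue].
    rewrite setE eqxx /=; apply/eqP/eqP => [/zap_set-> //|<-].
    by rewrite zapE eqxx.
  rewrite aE // /monomial big_cons setE eqxx mul1r; congr (_ * _).
  apply: eq_big_seq => f ft; rewrite ffunE; case: (f =P e) => // fe.
  by rewrite -fe ft in et.
have compY U : a U != 0 -> sv_comp U Y = sv_set e false U /\
    sv_comp U (sv_opp Y) = sv_set e true U.
  move=> aU; have Ue := a0 _ aU.
  have Yf f : f != e -> U f = szero -> Y f = szero.
    move=> fe Uf; apply/zerosP; apply: (subsetP (tope_zeros_sub (UT _ aU true) YM)).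
    by rewrite in_zeros ffunE (negbTE fe) Uf.
  split; apply/ffunP=> f; rewrite !ffunE; case: (eqVneq f e) => [->|fe];
    rewrite ?Ue ?eqxx ?Ye //=; case: eqP => //= Uf; by rewrite Uf Yf.
rewrite /iota (eq_lin (f' := fun U => delta R (sv_set e false U) - delta R (sv_set e true U))); last first.
  by move=> U /compY[-> ->].
apply/ffunP=> T; rewrite ffunE.
case Te: (T e) => [b|]; last first.
  rewrite gz // big1 // => U _; rewrite !ffunE.
  case: (T =P _) => [eq|_]; first by move: Te; rewrite eq setE.
  case: (T =P _) => [eq|_]; first by move: Te; rewrite eq setE.
  by rewrite subrr mulr0.
have zT : sv_zap e T e = szero by rewrite zapE eqxx.
rewrite (bigD1 (sv_zap e T)) //= big1 ?addr0; last first.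
  move=> U ne; case: (eqVneq (a U) 0) => [->|/a0 Ue]; first by rewrite mul0r.
  rewrite !ffunE; case: (T =P _) => [eq|_]; first by rewrite eq zap_set // eqxx in ne.
  case: (T =P _) => [eq|_]; first by rewrite eq zap_set // eqxx in ne.
  by rewrite subrr mulr0.
rewrite aE // !ffunE; case: b Te => Te.
  rewrite (set_zap Te) eqxx; case: (T =P _) => [eq|_].
    by move: Te; rewrite eq setE.
  by rewrite sub0r mulrN1 -gN // set_zap.
rewrite (set_zap Te) eqxx; case: (T =P _) => [eq|_]; last by rewrite subr0 mulr1.
by move: Te; rewrite {1}eq setE.
Qed.

End Deletion.

Section Spanning.
Variable E : finType.
Implicit Types (M : oriented_matroid E) (X Y T U : signvec E) (e : E).

Definition cube_span M p (g : {ffun signvec E -> 'F_2}) :=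
  exists2 l : seq (seq (E * signvec E) * signvec E),
    all (fun x => (size x.1 == p) && cube M x.1 x.2) l
    & g = \sum_(x <- l) cube_vec 'F_2 x.1 x.2.

Lemma F2_cases (x : 'F_2) : x = 0 \/ x = 1.
Proof. by case: x => [[|[|n]] h] //; [left|right]; apply/val_inj. Qed.

Lemma annihilated_span M p (g : {ffun signvec E -> 'F_2}) :
  on_topes M g -> annihilated p g -> cube_span M p g.
Proof.
have [n] := ubnP #|~: closure M set0|.
elim: n M p g => // n IH M [|p] g le_n gT gA.
  exists [seq ([::], T) | T <- enum [pred T | g T != 0]].
    by apply/allP=> _ /mapP[T + ->]; rewrite mem_enum => /gT.
  rewrite big_map big_enum /= -[LHS]lin_id; apply/ffunP=> T.
  rewrite ffunE sum_ffunE /= (bigID (fun U => g U != 0)) /= [X in _ + X]big1 ?addr0.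
    apply: eq_bigr => U; case: (F2_cases (g U)) => ->; first by rewrite eqxx.
    by rewrite mul1r.
  by move=> U; rewrite negbK => /eqP->; rewrite mul0r.
(* Without non-loops the only covector is 0, and the empty monomial, of degree below p + 1, kills
   its coefficient. *)
case: (set_0Vmem (~: closure M set0)) => [M0|[e]].
  exists [::] => //; rewrite big_nil; apply/ffunP=> T; rewrite [RHS]ffunE.
  have all0 X : X \in covectors M -> X = sv0 E.
    move=> XM; apply/ffunP=> f; rewrite ffunE.
    have : f \notin ~: closure M set0 by rewrite M0 inE.
    by rewrite inE negbK => /closureP; apply; rewrite ?sub0set.
  case: (eqVneq T (sv0 E)) => [->|ne]; last first.
    by apply/eqP; apply: contraNT ne => /gT/tope_cov/all0 ->.
  rewrite -[RHS](gA [::] isT) /pairing (bigD1 (sv0 E)) //= big1.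
    by rewrite /monomial big_nil mulr1 addr0.
  move=> U ne; apply/eqP; rewrite mulf_eq0; apply/orP; left.
  by apply: contraNT ne => /gT/tope_cov/all0 ->.
rewrite inE => e0.
have [Y YM Ye] : exists2 Y, Y \in covectors M & Y e = spos.
  have /nonloopP[Y YM] := e0; case Ye: (Y e) => [[]|] // _; last by exists Y.
  by exists (sv_opp Y); rewrite ?covectorsN // oppE Ye.
have [||l lC gl] := IH (delete M e) p.+1 (zap_lin e g) _ _ (annihilated_zap _ gA).
- exact: leq_trans (card_nonloops_delete e0) le_n.
- exact: on_topes_zap.
have [l' l'C gl'] : exists2 l', all (fun x => (size x.1 == p.+1) && cube M x.1 x.2) l'
    & zap_lin e g = zap_lin e (\sum_(x <- l') cube_vec 'F_2 x.1 x.2).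
  rewrite {}gl; elim: l lC => [_|[s T] l IHl /= /andP[/andP[sz sT] /IHl[l' l'C eq]]].
    by exists [::] => //; rewrite !big_nil /zap_lin lin0.
  have [s' [T' [sz' sT' eq']]] := @cube_lift _ 'F_2 _ _ _ _ sT.
  exists ((s', T') :: l'); first by rewrite /= sz' sz sT'.
  by rewrite !big_cons /= zap_linD eq' eq.
set r := \sum_(x <- l') _ in gl'.
have rT : on_topes M r.
  rewrite /r; elim: l' l'C {gl' r} => [|x l' IHl /= /andP[/andP[_ xC] xsC]].
    by move=> _ T; rewrite big_nil ffunE eqxx.
  by rewrite big_cons; apply: on_topesD (IHl xsC); apply: on_topes_cube xC.
(* Cubes satisfy the degree conditions, so these survive when the lift [r] is subtracted and
   [zap_kernel] applies to the difference. *)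
have rA : annihilated p.+1 r.
  move=> t le_t; rewrite pairing_sum big_seq big1 // => x xl.
  have /andP[/eqP sz /annihilated_cube] := allP l'C _ xl.
  by rewrite sz; apply.
have [|||a [aT aA ag]] := @zap_kernel _ _ M e Y (g - r) p YM Ye.
- exact: on_topesD gT (on_topesN rT).
- by rewrite zap_linB gl' subrr.
- by move=> t le_t; rewrite pairingB gA // rA // subrr.
have [|l2 l2C al2] := IH (contract M e) p a _ aT aA.
  exact: leq_trans (card_nonloops_contract e0) le_n.
exists (l' ++ [seq ((e, Y) :: x.1, x.2) | x <- l2]).
  rewrite all_cat l'C; apply/allP=> _ /mapP[x xl ->] /=.
  have /andP[/eqP-> ->] := allP l2C _ xl.
  by rewrite eqxx YM Ye.
rewrite big_cat big_map -/r /=.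
have -> : \sum_(x <- l2) iota Y (cube_vec 'F_2 x.1 x.2) = g - r.
  by rewrite -ag al2 [RHS]lin_sum.
by rewrite addrC subrK.
Qed.

End Spanning.

(** * The Kalinin filtration *)

Lemma F2_addff (x : 'F_2) : x + x = 0.
Proof. by case: (F2_cases x) => ->; apply/val_inj. Qed.

Lemma F2_oppr (x : 'F_2) : - x = x.
Proof. by apply/eqP; rewrite eq_sym -addr_eq0 F2_addff. Qed.

Lemma F2_addgg (P : finType) (g : {ffun P -> 'F_2}) : g + g = 0.
Proof. by apply/ffunP=> x; rewrite !ffunE F2_addff. Qed.

Lemma F2_oppg (P : finType) (g : {ffun P -> 'F_2}) : - g = g.
Proof. by apply/ffunP=> x; rewrite ffunE F2_oppr. Qed.

Section RawChains.
Variable E : finType.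
Implicit Types (M : oriented_matroid E) (X Y L T U : signvec E) (e f : E).

(** Bare pairs keep the chains of M and of its contractions in one type; being a cell becomes a
    condition on the support. *)
Definition cell := (signvec E * signvec E)%type.
Definition raw_chain := {ffun cell -> 'F_2}.
Implicit Types (b : raw_chain) (g : {ffun signvec E -> 'F_2}) (x : cell).

Definition covers M L X :=
  [&& X \in covectors M, sv_le L X & rank M (zeros L) == (rank M (zeros X)).+1].

Definition raw_boundary M b : raw_chain :=
  lin (fun x => \sum_(X | covers M x.1 X) delta 'F_2 (X, sv_comp X x.2)) b.

Definition raw_conj b : raw_chain :=
  lin (fun x => delta 'F_2 (x.1, sv_comp x.1 (sv_opp x.2))) b.

Definition raw_vertices g : raw_chain := lin (fun T => delta 'F_2 (T, T)) g.

(* A tope T of M/e is adjacent to the two topes T o Y and T o -Y of M, where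
   Y e != 0. The resulting map on cells is a chain map raising degrees by one. *)
Definition tube Y b : raw_chain :=
  lin (fun x => delta 'F_2 (x.1, sv_comp x.2 Y) +
                delta 'F_2 (x.1, sv_comp x.2 (sv_opp Y))) b.

Definition is_cell M x := [&& x.1 \in covectors M, x.2 \in topes M & sv_le x.1 x.2].

Definition cells_in_degree M i b :=
  forall x, b x != 0 -> is_cell M x /\ rank M (zeros x.1) = i.

Definition raw_kalinin M p g :=
  exists b : nat -> raw_chain,
    [/\ forall i, (1 <= i <= p)%N -> cells_in_degree M i (b i),
        (1 <= p)%N -> raw_boundary M (b 1%N) = raw_vertices g
      & forall i, (1 <= i < p)%N ->
          raw_boundary M (b i.+1) = b i + raw_conj (b i)].

Lemma cells_in_degreeD M i b b' : cells_in_degree M i b -> cells_in_degree M i b' ->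
  cells_in_degree M i (b + b').
Proof.
move=> h h' x; rewrite ffunE; case: (eqVneq (b x) 0) => [->|/h //].
by rewrite add0r => /h'.
Qed.

Lemma raw_boundaryD M : {morph raw_boundary M : b b' / b + b'}.
Proof. exact: linD. Qed.

Lemma raw_conjD : {morph raw_conj : b b' / b + b'}.
Proof. exact: linD. Qed.

Lemma raw_verticesD : {morph raw_vertices : g g' / g + g'}.
Proof. exact: linD. Qed.

Lemma tubeD Y : {morph tube Y : b b' / b + b'}.
Proof. exact: linD. Qed.

Lemma raw_kalininD M p g g' : raw_kalinin M p g -> raw_kalinin M p g' ->
  raw_kalinin M p (g + g').
Proof.
case=> b [h1 h2 h3] [b' [h1' h2' h3']]; exists (fun i => b i + b' i); split.
- by move=> i hi; apply: cells_in_degreeD; auto.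
- by move=> p0; rewrite raw_boundaryD raw_verticesD h2 // h2'.
- by move=> i hi; rewrite raw_boundaryD raw_conjD h3 // h3' // addrACA.
Qed.

Lemma raw_kalinin0 M p : raw_kalinin M p 0.
Proof.
exists (fun=> 0); split=> [i _ x|_|i _]; rewrite ?ffunE ?eqxx //.
  by rewrite [LHS]lin0 [RHS]lin0.
by rewrite [LHS]lin0 [raw_conj _]lin0 addr0.
Qed.

Lemma tope_compl M L T : L \in covectors M -> T \in topes M -> sv_comp L T \in topes M.
Proof.
move=> LM TM; apply: tope_zerosP; first exact: covectorsC (tope_cov TM).
move=> X XM; rewrite zeros_comp; apply: subset_trans (subsetIr _ _) _.
exact: tope_zeros_sub TM XM.
Qed.

Lemma tope_comp_id M T X : T \in topes M -> X \in covectors M -> sv_comp T X = T.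
Proof. by case/topeP=> _; apply. Qed.

Section Tube.
Variables (M : oriented_matroid E) (e : E) (Y : signvec E).
Hypotheses (YM : Y \in covectors M) (Ye : Y e != szero).

Lemma nonloop_witness : e \notin closure M set0.
Proof. by apply/nonloopP; exists Y. Qed.

Lemma rank_contract_zeros L : L e = szero ->
  rank M (zeros L) = (rank (contract M e) (zeros L)).+1.
Proof.
by move=> Le; apply: rank_contract; [apply/zerosP | apply: nonloop_witness].
Qed.

(** A cover [X] of [L] that is non-zero at [e] makes X o T a tope already; the two sides of the tube
    then give the same facet and cancel. The other covers are those of M/e, with all ranks shifted
    by one. *)
Lemma raw_boundary_tube b : (forall x, b x != 0 -> is_cell (contract M e) x) ->
  raw_boundary M (tube Y b) = tube Y (raw_boundary (contract M e) b).
Proof.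
move=> bC; rewrite /raw_boundary /tube !lin_comp; apply: eq_lin => -[L T] /bC.
case/and3P=> /= LM TM LT; have Le := ctr_zero LM.
rewrite linD !lin_delta -big_split lin_sum /=.
rewrite (bigID (fun X : signvec E => X e == szero)) /=.
rewrite [X in _ + X]big1 ?addr0; last first.
  move=> X /andP[/and3P[XM _ _] Xe].
  have TXM : sv_comp T X \in topes M by apply: comp_contract_tope TM.
  have absorb Z : Z \in covectors M -> sv_comp X (sv_comp T Z) = sv_comp X T.
    move=> ZM; rewrite compA; apply: comp_tope_absorb.
    rewrite zeros_comp setIC -zeros_comp; exact: tope_zeros_sub TXM ZM.
  by rewrite !absorb ?covectorsN // F2_addgg.
apply: eq_big => [X|X _]; last by rewrite lin_delta /= !compA.
rewrite /covers in_ctr /=; case: (X e =P szero) => [Xe|]; last by rewrite !andbF.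
by rewrite !andbT !rank_contract_zeros // eqSS.
Qed.

Lemma raw_conj_tube b : raw_conj (tube Y b) = tube Y (raw_conj b).
Proof.
rewrite /raw_conj /tube !lin_comp; apply: eq_lin => -[L T] _ /=.
rewrite linD !lin_delta /= !opp_comp !compA sv_oppK addrC //.
Qed.

(** A tope of M/e has a zero set of rank 1 in M, so it indexes edges, and [edge_tope] leaves only
    two endpoints. *)
Lemma covers_contract_tope U X : U \in topes (contract M e) ->
  covers M U X = (X \in [set sv_comp U Y; sv_comp U (sv_opp Y)]).
Proof.
move=> UT; have UM := tope_cov UT; have Ue := ctr_zero UM.
have rU : rank M (zeros U) = 1%N by rewrite rank_contract_zeros // rank_tope.
have T1 : sv_comp U Y \in topes M by apply: comp_contract_tope UT.
have T2 : sv_comp U (sv_opp Y) \in topes M.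
  by apply: comp_contract_tope UT; rewrite ?covectorsN ?opp_eq0.
rewrite /covers rU in_set2; apply/and3P/orP.
  case=> XM UX /eqP[/esym/(rank0_tope XM) XT].
  case: (edge_tope (ctr_sub UM) rU T1 XT (sv_le_comp _ _) UX) => ->; first by left.
  by right; rewrite comp_oppl.
by case=> /eqP->; rewrite sv_le_comp rank_tope // tope_cov.
Qed.

Lemma comp_neq_opp U : U e = szero -> sv_comp U Y != sv_comp U (sv_opp Y).
Proof.
move=> Ue; apply: contra Ye => /eqP/ffunP/(_ e); rewrite !comp_zero // oppE.
by case: (Y e) => [[]|].
Qed.

Lemma raw_kalinin_tube p g : on_topes (contract M e) g ->
  raw_kalinin (contract M e) p g -> raw_kalinin M p.+1 (iota Y g).
Proof.
move=> gT [b [h1 h2 h3]].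
(* For each tope [U] of M/e, one of the two conjugate edges over it; its endpoints are the two terms
   of [iota]. *)
pose b1 : raw_chain := lin (fun U => delta 'F_2 (U, sv_comp U Y)) g.
have YMN := covectorsN YM.
have YeN : sv_opp Y e != szero by rewrite opp_eq0.
(* Tubes raise degrees by one, so the given sequence moves up one place to make room for [b1]; the
   value at 0 is a default. *)
exists (fun i => if i is i'.+2 then tube Y (b i'.+1) else b1); split.
- case=> [|[|i]] //= hi x /lin_neq0[].
    move=> U /gT UT; rewrite deltaE; case: (x =P _) => [-> _|]; last by rewrite eqxx.
    have UM := tope_cov UT.
    rewrite rank_contract_zeros ?(ctr_zero UM) // rank_tope //; split=> //.
    by rewrite /is_cell /= (ctr_sub UM) sv_le_comp (comp_contract_tope YM Ye).
  move=> [L T] /(h1 i.+1 hi)[/and3P[/= LM TM LT] rL].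
  case: x => L' T'; rewrite !ffunE !xpair_eqE /=.
  case: (L' =P L) => [->|]; last by rewrite addr0 eqxx.
  rewrite /is_cell /= (ctr_sub LM) rank_contract_zeros ?rL ?(ctr_zero LM) //=.
  case: (T' =P _) => [-> _|_].
    by rewrite (comp_contract_tope YM Ye) // le_compr.
  case: (T' =P _) => [-> _|]; last by rewrite addr0 eqxx.
  by rewrite (comp_contract_tope YMN YeN) // le_compr.
- move=> _; rewrite /raw_boundary /raw_vertices /iota !lin_comp.
  apply: eq_lin => U /gT UT; rewrite lin_delta linB !lin_delta /= F2_oppg.
  rewrite (eq_bigl _ _ (fun X => covers_contract_tope X UT)).
  have Ue := ctr_zero (tope_cov UT).
  rewrite big_setU1 ?inE ?comp_neq_opp //= big_set1.
  have idem Z Z' : Z \in covectors M -> Z' \in covectors M -> Z e != szero ->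
      sv_comp (sv_comp U Z) (sv_comp U Z') = sv_comp U Z.
    move=> ZM Z'M Ze; have UZ := comp_contract_tope ZM Ze UT.
    by apply: tope_comp_id UZ _; rewrite covectorsC // (ctr_sub (tope_cov UT)).
  by rewrite !idem.
- case=> [|[|i]] // hi.
    (* The tube over the vertex [U] is the sum of both edges over [U], that is, [b1] plus its
       conjugate. *)
    rewrite raw_boundary_tube; last by move=> x /(h1 1%N) [].
    rewrite h2 // /tube /raw_vertices /raw_conj /b1 !lin_comp -lin_addf.
    by apply: eq_lin => U _; rewrite !lin_delta /= comp_oppl.
  rewrite raw_boundary_tube; last first.
    by move=> x /(h1 i.+2 _) []; rewrite ?(ltnW hi).
  by rewrite h3 // raw_conj_tube tubeD.
Qed.

End Tube.

Lemma raw_kalinin_cube M s T : cube M s T ->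
  raw_kalinin M (size s) (cube_vec 'F_2 s T).
Proof.
elim: s M => [|[e Y] s IH] M /=.
  by move=> _; exists (fun=> 0); split=> // -[|i].
case/and3P=> YM Ye sT.
exact: raw_kalinin_tube YM Ye _ _ (on_topes_cube sT) (IH _ sT).
Qed.

Lemma raw_kalinin_span M p g : cube_span M p g -> raw_kalinin M p g.
Proof.
case=> l lC ->; elim: l lC => [|x l IH] /=; first by rewrite big_nil => _; apply: raw_kalinin0.
case/andP=> /andP[/eqP sz xC] lC; rewrite big_cons.
by apply: raw_kalininD; [rewrite -sz; apply: raw_kalinin_cube | apply: IH].
Qed.

End RawChains.

Lemma big_codom_inj (R : nmodType) (I J : finType) (h : I -> J) (F : J -> R) :
  injective h -> (forall j, F j != 0 -> exists i, j = h i) ->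
  \sum_j F j = \sum_i F (h i).
Proof.
move=> h_inj hF; rewrite (bigID (mem (codom h))) /= [X in _ + X]big1 ?addr0.
  have uc : uniq (codom h) by rewrite map_inj_uniq // enum_uniq.
  rewrite -big_uniq //= codomE big_map.
  by rewrite -[in RHS]big_enum.
move=> j jN; apply/eqP; apply: contraNT jN => /hF[i ->]; exact: codom_f.
Qed.

Lemma compXX (E : finType) (X : signvec E) : sv_comp X X = X.
Proof. exact: comp_tope_absorb. Qed.

(** * From raw chains to cellular chains *)

Section Salvetti.
Variables (E : finType) (M : oriented_matroid E).
Implicit Types (X Y L T U : signvec E) (e f : E) (c d : salvetti_index M).
Implicit Types (b : raw_chain E) (t : tope M) (gamma : tope_space M 'F_2).

Definition raw c : cell E := (val (cov_of c), val (tope_of c)).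

Lemma raw_inj : injective raw.
Proof.
move=> c d [/val_inj eL /val_inj eT]; apply/val_inj; move: eL eT.
by rewrite /cov_of /tope_of; case: (val c) => L T; case: (val d) => L' T' /= -> ->.
Qed.

Lemma is_cell_raw c : is_cell M (raw c).
Proof.
by rewrite /is_cell /=; apply/and3P; split; [apply: valP | apply: valP | apply: (valP c)].
Qed.

Lemma is_cellP x : is_cell M x -> exists c, x = raw c.
Proof.
case: x => L T /and3P[/= LM TM LT].
pose L' : covector M := exist (fun X => X \in covectors M) L LM.
pose T' : tope M := exist (fun X => X \in topes M) T TM.
pose c : salvetti_index M :=
  exist (fun c : covector M * tope M => sv_le (val c.1) (val c.2)) (L', T') LT.
by exists c.
Qed.

(** Inclusion of balls is decided by one simplex, the single vertex w(L,T) at the centre of the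
    smaller ball; conversely the vertices transfer by [comp_absorb]. *)
Lemma facetE c' c : facet c' c =
  [&& sv_le (raw c).1 (raw c').1,
      rank M (zeros (raw c).1) == (rank M (zeros (raw c').1)).+1
    & (raw c').2 == sv_comp (raw c').1 (raw c).2].
Proof.
rewrite /facet /cell_dim; case: eqP => [_|]; last by rewrite /= andbF.
have vert_ball d : [set mk_index (cov_of d) (tope_of d)] \in ball d.
  rewrite inE; apply/andP; split.
    apply/andP; split.
      by apply/set0Pn; exists (mk_index (cov_of d) (tope_of d)); rewrite inE.
    apply/forallP=> x; apply/implyP=> /set1P->.
    apply/forallP=> y; apply/implyP=> /set1P->.
    rewrite /fine_le sv_le_refl /=; apply/orP; left; apply/eqP/val_inj => /=.
    by rewrite compA compXX.
  by rewrite sub1set; apply: imset_f; rewrite inE sv_le_refl.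
apply/subsetP/andP => [/(_ _ (vert_ball c'))|[le /eqP eqT] s].
  rewrite inE => /andP[_]; rewrite sub1set => /imsetP[L'].
  rewrite inE => le /(congr1 raw)[/= eqL eqT]; rewrite eqL.
  split=> //; rewrite -eqT eq_sym; apply/eqP/le_comp_id.
  by have /and3P[] := is_cell_raw c'.
rewrite !inE => /andP[-> /subsetP sub]; apply/subsetP=> w /sub /imsetP[L'].
rewrite inE => le' ->; apply/imsetP; exists L'.
  by rewrite inE; apply: sv_le_trans le le'.
apply: raw_inj; congr pair => /=; move: eqT => /= ->.
exact: comp_absorb le'.
Qed.

Definition restrict (b : raw_chain E) : chain M := [ffun c => b (raw c)].

Lemma restrict_lin b (F : cell E -> raw_chain E) c : (forall x, b x != 0 -> is_cell M x) ->
  restrict (lin F b) c = \sum_d restrict b d * F (raw d) (raw c).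
Proof.
move=> bC; rewrite !ffunE (big_codom_inj raw_inj).
  by apply: eq_bigr => d _; rewrite ffunE.
move=> x; case: (eqVneq (b x) 0) => [->|/bC/is_cellP //].
by rewrite mul0r eqxx.
Qed.

Lemma boundary_restrict b : (forall x, b x != 0 -> is_cell M x) ->
  boundary (restrict b) = restrict (raw_boundary M b).
Proof.
move=> bC; apply/ffunP=> c'; rewrite restrict_lin // ffunE big_mkcond /=.
apply: eq_bigr => c _; rewrite facetE sum_ffunE.
have := is_cell_raw c'; case: (raw c') => L' T' /and3P[/= L'M _ _].
have -> : \sum_(X | covers M (val (cov_of c)) X)
      delta 'F_2 (X, sv_comp X (val (tope_of c))) (L', T') =
    (covers M (val (cov_of c)) L' && (T' == sv_comp L' (val (tope_of c))))%:R.
  case: (boolP (covers _ _ L')) => [cov|ncov] /=.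
    rewrite (bigD1 L') //= deltaE xpair_eqE eqxx big1 ?addr0 // => X /andP[_ ne].
    by rewrite deltaE xpair_eqE eq_sym (negbTE ne).
  rewrite big1 // => X cov; rewrite deltaE xpair_eqE; case: eqP => // eq.
  by rewrite eq cov in ncov.
rewrite /covers L'M /= -andbA; case: ifP => _; [by rewrite mulr1|by rewrite mulr0].
Qed.

Lemma conj_restrict b : (forall x, b x != 0 -> is_cell M x) ->
  chain_conj (restrict b) = restrict (raw_conj b).
Proof.
move=> bC; apply/ffunP=> c'; rewrite restrict_lin // ffunE big_mkcond /=.
apply: eq_bigr => c _; rewrite deltaE -[(val _, _)]/(raw (cell_conj c)).
by rewrite (inj_eq raw_inj) eq_sym; case: eqP => _; rewrite ?mulr1 ?mulr0.
Qed.

Definition extend (R : comNzRingType) (g : tope_space M R) : {ffun signvec E -> R} :=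
  lin (fun t : tope M => delta R (val t)) g.

Lemma extend_val (R : comNzRingType) (g : tope_space M R) t : extend g (val t) = g t.
Proof.
rewrite ffunE (bigD1 t) //= deltaE eqxx mulr1 big1 ?addr0 // => t' ne.
by rewrite deltaE (inj_eq val_inj) eq_sym (negbTE ne) mulr0.
Qed.

Lemma on_topes_extend (R : comNzRingType) (g : tope_space M R) : on_topes M (extend g).
Proof.
move=> T /lin_neq0[t _]; rewrite deltaE; case: (T =P _) => [-> _|].
  exact: valP.
by rewrite eqxx.
Qed.

Lemma pairing_extend (R : comNzRingType) (g : tope_space M R) (m : signvec E -> R) :
  pairing m (extend g) = \sum_t g t * m (val t).
Proof.
by rewrite pairing_lin; apply: eq_bigr => t _; rewrite pairing_delta.
Qed.

Lemma raw_vertex t : raw (vertex t) = (val t, val t).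
Proof. by congr pair; apply: comp_tope_absorb. Qed.

Lemma vertex_chain_restrict gamma :
  vertex_chain gamma = restrict (raw_vertices (extend gamma)).
Proof.
apply/ffunP=> c; rewrite [LHS]ffunE [RHS]ffunE /raw_vertices /extend lin_comp.
rewrite ffunE big_mkcond /=.
apply: eq_bigr => t _; rewrite lin_delta deltaE -raw_vertex (inj_eq raw_inj) eq_sym.
by case: eqP => _; rewrite ?mulr1 ?mulr0.
Qed.

Lemma kalinin_of_raw p gamma : raw_kalinin M p (extend gamma) -> kalinin p gamma.
Proof.
case=> b [h1 h2 h3]; rewrite /kalinin; case: eqP => // /eqP p0.
have bC i : (1 <= i <= p)%N -> forall x, b i x != 0 -> is_cell M x.
  by move=> hi x /(h1 i hi)[].
exists (fun i => restrict (b i)); split.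
- by move=> i hi c; rewrite ffunE => /(h1 i hi)[].
- rewrite boundary_restrict; last by apply: (bC 1%N); rewrite /= lt0n.
  by rewrite h2 ?lt0n // vertex_chain_restrict.
- case=> [|[|i]] // hi; rewrite boundary_restrict; last exact: (bC i.+2 hi).
  rewrite /= conj_restrict; last exact: (bC i.+1 (ltnW hi)).
  by rewrite h3 //; apply/ffunP=> c; rewrite !ffunE.
Qed.

End Salvetti.

(** * Heaviside functions as equivariant cochains *)

Section EquivariantCochains.
Variables (E : finType) (M : oriented_matroid E).
Implicit Types (X Y L T U : signvec E) (e f : E) (s : seq E).

Definition heav e X : 'F_2 := (X e == spos)%:R.

(** The sign of [T] selects one of two conjugate cells, so that the coboundary of [heav e] is this
    cochain plus its conjugate, as [heav_cross] records. *)
Definition crossing e X L T : 'F_2 :=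
  ((L e == szero) && (X e == spos) && (T e == spos))%:R.

(* h_e extends to an equivariant class with components the 0-cochain [heav e] and
   the 1-cocycle [crossing e]. [cochain s] collects the components, of all
   degrees, of the cup product of these classes for e in s; the component of
   degree i is its restriction to the cells of dimension i. *)
Fixpoint cochain s L T : 'F_2 :=
  if s is e :: s' then
    heav e L * cochain s' L (sv_comp L (sv_opp T)) +
    \sum_(X | covers M L X) crossing e X L T * cochain s' X (sv_comp X T)
  else (rank M (zeros L) == 0%N)%:R.

Definition coboundary (phi : signvec E -> signvec E -> 'F_2) L T :=
  \sum_(X | covers M L X) phi X (sv_comp X T).

Lemma coversP L X :
  reflect [/\ X \in covectors M, sv_le L X & rank M (zeros L) = (rank M (zeros X)).+1]
          (covers M L X).
Proof. by apply: (iffP and3P) => -[? ? /eqP]. Qed.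

(** The unit lives in degree 0 and each factor raises the degree by at most one. *)
Lemma cochain_eq0 s L T : (size s < rank M (zeros L))%N -> cochain s L T = 0.
Proof.
elim: s L T => [|e s IH] L T /= lt; first by rewrite eqn0Ngt lt.
rewrite IH ?mulr0 ?add0r; last exact: ltnW.
by rewrite big1 // => X /coversP[_ _ rL]; rewrite IH ?mulr0 // -ltnS -rL.
Qed.

Lemma cochain_tope s T : T \in topes M -> cochain s T T = monomial 'F_2 s T.
Proof.
move=> TM; have TT := tope_cov TM; elim: s => [|e s IH] /=.
  by rewrite rank_tope // /monomial big_nil.
rewrite (tope_comp_id TM) ?covectorsN // IH big1 ?addr0.
  by rewrite /monomial big_cons.
by move=> X /coversP[_ _]; rewrite rank_tope.
Qed.

Lemma sum_two_equal (P : pred (signvec E)) (X1 X2 : signvec E) (a : 'F_2) F :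
    X1 != X2 -> (forall X, P X = (X \in [set X1; X2])) ->
    (forall X, P X -> F X = a) ->
  \sum_(X | P X) F X = 0.
Proof.
move=> ne PE Fa; rewrite (eq_bigr (fun=> a)) // (eq_bigl _ _ PE).
by rewrite big_setU1 ?inE //= big_set1 F2_addff.
Qed.

Lemma coboundary_unit L T : L \in covectors M ->
  coboundary (cochain [::]) L T = 0.
Proof.
move=> LM; have [U UM LU] := tope_ex LM.
case: (posnP (rank M (zeros L))) => [r0|r_gt0].
  by rewrite /coboundary big1 // => X /coversP[_ _]; rewrite r0.
case: (ltnP 1 (rank M (zeros L))) => [r_gt1|r_le1].
  by rewrite /coboundary big1 // => X /coversP[_ _ rL] /=; rewrite -eqSS -rL gtn_eqF.
have r1 : rank M (zeros L) = 1%N by apply/eqP; rewrite eqn_leq r_le1.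
have U'M : sv_comp L (sv_opp U) \in topes M.
  by apply: tope_compl => //; apply: (valP (tope_opp (exist (fun X => X \in topes M) U UM))).
apply: (@sum_two_equal _ U (sv_comp L (sv_opp U)) 1).
- apply: contraTneq r_gt0 => /ffunP eqU; rewrite -leqNgt leqn0.
  suff eLU : L = U by rewrite eLU rank_tope.
  apply: le_zeros_eq LU _; apply/subsetP=> f /zerosP Lf; apply/zerosP.
  by move: (eqU f); rewrite comp_zero // oppE; case: (U f) => [[]|].
- move=> X; rewrite /covers r1 in_set2; apply/and3P/orP.
    case=> XM LX /eqP[/esym/(rank0_tope XM) XT].
    by case: (edge_tope LM r1 UM XT LU LX) => ->; [left|right].
  by case=> /eqP->; rewrite rank_tope ?tope_cov ?sv_le_comp.
- by move=> X /coversP[_ _ /eqP] /=; rewrite r1 eqSS eq_sym => ->.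
Qed.

(* By the diamond property each Z of corank two above L is reached through exactly
   two covectors X, and these contribute equal terms. *)
Lemma crossing_cocycle e s L T : L \in covectors M ->
  \sum_(X | covers M L X) \sum_(Z | covers M X Z)
     crossing e Z X (sv_comp X T) * cochain s Z (sv_comp Z (sv_comp X T)) =
  \sum_(X | covers M L X) crossing e X L T * coboundary (cochain s) X (sv_comp X T).
Proof.
move=> LM; apply/eqP; rewrite -subr_eq0 -sumrB.
under eq_bigr => X _ do rewrite mulr_sumr -sumrB.
rewrite (exchange_big_dep xpredT) //= big1 // => Z _.
case: (pickP (fun X => covers M L X && covers M X Z)) => [X0|none]; last first.
  by rewrite big_pred0.
move=> /andP[/coversP[X0M LX0 rL] /coversP[ZM X0Z rX0]].
have LZ := sv_le_trans LX0 X0Z; have rLZ : rank M (zeros L) = (rank M (zeros Z)).+2.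
  by rewrite rL rX0.
have [X1 [X2 [ne /setP eqS]]] := diamond LM ZM LZ rLZ.
pose a := ((L e == szero) && (Z e == spos) && (T e == spos))%:R * cochain s Z (sv_comp Z T).
apply: (sum_two_equal (a := a) ne) => [X|X /andP[/coversP[XM LX _] /coversP[_ XZ _]]].
  rewrite -eqS inE /covers ZM /=; case XM: (X \in covectors M) => //=.
  rewrite rLZ eqSS (eq_sym (rank M (zeros Z)).+1).
  by case: (sv_le L X); case: (sv_le X Z); case: (_ == _).
rewrite !comp_absorb // -mulrBl F2_oppr; congr (_ * _); rewrite /crossing.
have /sv_leP/(_ e) := LX; have /sv_leP/(_ e) := XZ.
case: (eqVneq (L e) szero) => [_ XZe _|Le XZe /(_ isT) XLe] /=.
  case: (eqVneq (X e) szero) XZe => [Xe _|Xe /(_ isT) ->] /=.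
    by rewrite comp_zero // Xe addr0.
  by rewrite add0r.
have Xe : X e != szero by rewrite XLe.
by rewrite (negbTE Xe) addr0.
Qed.

Lemma heav_cross e L X T : T \in topes M -> X \in covectors M -> sv_le L X ->
  heav e X = heav e L + (crossing e X L T + crossing e X L (sv_comp L (sv_opp T))).
Proof.
move=> TM XM /sv_leP/(_ e) LX; rewrite /heav /crossing.
case: (eqVneq (L e) szero) LX => [Le _|Le /(_ isT) ->] /=; last by rewrite !addr0.
rewrite Le add0r comp_zero // oppE; case: (eqVneq (X e) spos) => Xe /=; last by rewrite addr0.
have : T e != szero.
  apply: contraTneq isT => /zerosP/(subsetP (tope_zeros_sub TM XM)).
  by rewrite in_zeros Xe.
by case: (T e) => [[]|] // _; rewrite /= ?addr0 ?add0r.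
Qed.

(** A Leibniz rule by induction on [s]: the new factor contributes through [heav_cross], the old
    ones through the induction hypothesis, once directly and once under [crossing]. The mixed term,
    [crossing] at [T] times the conjugate cochain, occurs twice and cancels. *)
Lemma coboundary_cochain s L T : L \in covectors M -> T \in topes M -> sv_le L T ->
  coboundary (cochain s) L T = cochain s L T + cochain s L (sv_comp L (sv_opp T)).
Proof.
elim: s L T => [|e s IH] L T LM TM LT.
  by rewrite coboundary_unit //= F2_addff.
have TNM : sv_opp T \in topes M.
  exact: (valP (tope_opp (exist (fun X => X \in topes M) T TM))).
rewrite /coboundary /= big_split /= crossing_cocycle //.
have oppT X : sv_comp X (sv_opp (sv_comp X T)) = sv_comp X (sv_opp T) by exact: comp_oppl.
have step1 : \sum_(X | covers M L X)
      heav e X * cochain s X (sv_comp X (sv_opp (sv_comp X T))) =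
    heav e L * coboundary (cochain s) L (sv_comp L (sv_opp T)) +
    \sum_(X | covers M L X) (crossing e X L T + crossing e X L (sv_comp L (sv_opp T))) *
       cochain s X (sv_comp X (sv_opp T)).
  rewrite mulr_sumr -big_split; apply: eq_bigr => X /coversP[XM LX _] /=.
  by rewrite oppT (heav_cross e TM XM LX) mulrDl comp_absorb.
have LTN : sv_le L (sv_comp L (sv_opp T)) by apply: sv_le_comp.
rewrite step1 IH //; last exact: tope_compl.
have -> : sv_comp L (sv_opp (sv_comp L (sv_opp T))) = T.
  by rewrite comp_oppl sv_oppK le_comp_id.
have step2 : \sum_(X | covers M L X) crossing e X L T * coboundary (cochain s) X (sv_comp X T) =
    \sum_(X | covers M L X) crossing e X L T *
      (cochain s X (sv_comp X T) + cochain s X (sv_comp X (sv_opp T))).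
  apply: eq_bigr => X /coversP[XM LX _]; congr (_ * _).
  by rewrite IH ?oppT ?sv_le_comp //; apply: tope_compl.
rewrite step2 mulrDr [RHS]addrACA -[LHS]addrA; congr (_ + _); rewrite -!big_split.
apply: eq_bigr => X /coversP[XM LX _] /=; rewrite (comp_absorb _ LX) mulrDl mulrDr.
by rewrite [X in _ + X]addrC addrACA F2_addff add0r addrC.
Qed.

Definition cell_pairing s (b : chain M) : 'F_2 :=
  \sum_c b c * cochain s (raw c).1 (raw c).2.

Lemma cell_pairing_boundary s b :
  cell_pairing s (boundary b) = cell_pairing s (b + chain_conj b).
Proof.
rewrite /cell_pairing.
transitivity (\sum_c b c * coboundary (cochain s) (raw c).1 (raw c).2).
  under eq_bigr do rewrite ffunE mulr_suml.
  rewrite (exchange_big_dep xpredT) //=; apply: eq_bigr => c _.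
  rewrite -mulr_sumr; congr (_ * _); rewrite /coboundary.
  pose F (x : cell E) := if covers M (raw c).1 x.1 && (x.2 == sv_comp x.1 (raw c).2)
    then cochain s x.1 x.2 else 0.
  transitivity (\sum_x F x).
    rewrite (big_codom_inj (@raw_inj _ M)) /= => [|x].
      rewrite big_mkcond; apply: eq_bigr => d _; rewrite facetE /F /covers.
      by have /and3P[-> _ _] := is_cell_raw d; rewrite andTb andbA.
    rewrite /F; case: ifP; last by rewrite eqxx.
    case/andP=> /coversP[XM LX _] /eqP eqT _; apply: is_cellP; apply/and3P; split=> //.
      by rewrite eqT; apply: tope_compl => //; apply: (valP (tope_of c)).
    by rewrite eqT sv_le_comp.
  rewrite -(pair_bigA _ (fun X T => F (X, T))) /= [RHS]big_mkcond; apply: eq_bigr => X _.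
  rewrite (bigD1 (sv_comp X (raw c).2)) //= /F /= eqxx andbT big1 ?addr0 // => T ne.
  by rewrite (negbTE ne) andbF.
rewrite [RHS](eq_bigr (fun c => b c * cochain s (raw c).1 (raw c).2 +
   chain_conj b c * cochain s (raw c).1 (raw c).2)); last first.
  by move=> c _; rewrite !ffunE mulrDl.
rewrite [RHS]big_split /=.
under [X in _ = _ + X]eq_bigr do rewrite ffunE mulr_suml.
rewrite [X in _ = _ + X](exchange_big_dep xpredT) //= -big_split.
apply: eq_bigr => c _ /=; rewrite (eq_bigl (pred1 (cell_conj c))) ?big_pred1_eq.
  have /and3P[LM TM LT] := is_cell_raw c.
  by rewrite coboundary_cochain // mulrDr.
by move=> d; rewrite /= eq_sym.
Qed.

Lemma annihilated_kalinin p (gamma : tope_space M 'F_2) : kalinin p gamma -> annihilated p (extend gamma).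
Proof.
rewrite /kalinin; case: eqP => [-> _ t //|/eqP p0 [b [h1 h2 h3]]] s lt_s.
(* The pairing turns the boundary of b_i into b_i plus its conjugate, which is the boundary of
   b_(i+1). *)
have tele i : (1 <= i <= p)%N ->
    cell_pairing s (boundary (b 1%N)) = cell_pairing s (boundary (b i)).
  elim: i => // -[|i] IHi // hi; rewrite IHi; last by rewrite (ltnW hi).
  by rewrite (h3 i.+2 hi) /= cell_pairing_boundary.
transitivity (cell_pairing s (boundary (b 1%N))).
  rewrite h2 pairing_extend /cell_pairing.
  under [RHS]eq_bigr do rewrite ffunE mulr_suml.
  rewrite (exchange_big_dep xpredT) //=; apply: eq_bigr => T _.
  rewrite (eq_bigl (pred1 (vertex T))) ?big_pred1_eq.
    rewrite -[cochain _ _ _]/(cochain s (raw (vertex T)).1 (raw (vertex T)).2).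
    by rewrite raw_vertex cochain_tope //; apply: valP.
  by move=> c; rewrite /= eq_sym.
have hp : (1 <= p <= p)%N by rewrite leqnn andbT lt0n.
(* What remains is supported in dimension p, above the length of [s], where the cochain vanishes. *)
rewrite (tele p hp) cell_pairing_boundary /cell_pairing big1 // => c _.
have vanish d : b p d != 0 -> forall T, cochain s (raw d).1 T = 0.
  by move=> /(h1 p hp) rd T; rewrite cochain_eq0 // -[rank _ _]/(cell_dim d) rd.
have vanish0 d T : b p d * cochain s (raw d).1 T = 0.
  by case: (eqVneq (b p d) 0) => [->|/vanish->]; rewrite ?mul0r ?mulr0.
rewrite ffunE mulrDl vanish0 add0r ffunE mulr_suml big1 // => d /eqP <-.
exact: vanish0.
Qed.

End EquivariantCochains.

(** * The Quillen filtration *)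

Section GroupAlgebra.
Variable E : finType.
Implicit Types (a b c y : galg E) (u v w : F2vec E) (V : {vspace F2vec E}).
Implicit Types (r : seq (E * 'F_2)).

Lemma sum_galg_mul a b (F : F2vec E -> 'F_2) :
  \sum_w galg_mul a b w * F w = \sum_v a v * \sum_u b u * F (u + v).
Proof.
under eq_bigr do rewrite ffunE mulr_suml.
rewrite exchange_big; apply: eq_bigr => v _ /=; rewrite mulr_sumr.
rewrite (reindex_inj (addIr v)); apply: eq_bigr => u _ /=.
by rewrite addrK mulrA.
Qed.

Lemma galg_mulC : commutative (@galg_mul E).
Proof.
move=> a b; apply/ffunP=> w; rewrite !ffunE (reindex_inj (can_inj (subKr w))) /=.
by apply: eq_bigr => v _; rewrite subKr mulrC.
Qed.

Lemma galg_mulA : associative (@galg_mul E).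
Proof.
move=> a b c; apply/ffunP=> w; rewrite !ffunE sum_galg_mul.
apply: eq_bigr => v _; rewrite ffunE; congr (_ * _); apply: eq_bigr => u _.
by rewrite opprD addrA addrAC.
Qed.

Lemma galg_mulDr a : {morph galg_mul a : b c / b + c}.
Proof.
move=> b c; apply/ffunP=> w; rewrite !ffunE -big_split; apply: eq_bigr => v _.
by rewrite !ffunE mulrDr.
Qed.

Lemma galg_mulr0 a : galg_mul a 0 = 0.
Proof. by apply/ffunP=> w; rewrite !ffunE big1 // => v _; rewrite ffunE mulr0. Qed.

Lemma galg_mul_sumr a I (r : seq I) (F : I -> galg E) :
  galg_mul a (\sum_(i <- r) F i) = \sum_(i <- r) galg_mul a (F i).
Proof. exact: (big_morph _ (galg_mulDr a) (galg_mulr0 a)). Qed.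

Lemma galg_basis_mul v a w : galg_mul (galg_basis v) a w = a (w - v).
Proof.
rewrite ffunE (bigD1 v) //= ffunE eqxx mul1r big1 ?addr0 // => u ne.
by rewrite ffunE (negbTE ne) mul0r.
Qed.

Lemma galg_basis0 a : galg_mul (galg_basis 0) a = a.
Proof. by apply/ffunP=> w; rewrite galg_basis_mul subr0. Qed.

Lemma galg_basisD u v : galg_mul (galg_basis u) (galg_basis v) = galg_basis (u + v).
Proof. by apply/ffunP=> w; rewrite galg_basis_mul !ffunE subr_eq addrC. Qed.

(** The constants make this family stable under translation; a Heaviside factor mod 2 has constant
    1. *)
Definition affine_monomial r u : 'F_2 := \prod_(x <- r) (u x.1 + x.2).

Definition linear_part r := [seq (x.1, 0 : 'F_2) | x <- r].

Definition shift_monomial v r := [seq (x.1, v x.1 + x.2) | x <- r].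

Lemma affine_monomial_shift r u v :
  affine_monomial r (u + v) = affine_monomial (shift_monomial v r) u.
Proof.
rewrite /affine_monomial big_map; apply: eq_bigr => x _ /=.
by rewrite ffunE addrA.
Qed.

Lemma linear_part_shift v r : linear_part (shift_monomial v r) = linear_part r.
Proof. by rewrite /linear_part -map_comp. Qed.

(* Changing one of the constants in a product of p affine factors changes it by a
   product of p - 1 factors. *)
Lemma sum_linear_part y p :
    (forall r, (size r < p)%N -> \sum_u y u * affine_monomial r u = 0) ->
  forall r, (size r <= p)%N ->
    \sum_u y u * affine_monomial r u = \sum_u y u * affine_monomial (linear_part r) u.
Proof.
move=> y0; suff gen r r0 : (size r + size r0 <= p)%N ->
    \sum_u y u * (affine_monomial r u * affine_monomial r0 u) =
    \sum_u y u * (affine_monomial (linear_part r) u * affine_monomial r0 u).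
  move=> r le_r; have := gen r [::]; rewrite addn0 => /(_ le_r).
  under eq_bigr do rewrite [affine_monomial [::] _]big_nil mulr1.
  by under [X in _ = X -> _]eq_bigr do rewrite [affine_monomial [::] _]big_nil mulr1.
elim: r r0 => // -[e c] r IH r0 /= le_p.
have consE x q u : affine_monomial (x :: q) u = (u x.1 + x.2) * affine_monomial q u.
  exact: big_cons.
transitivity (\sum_u y u * (affine_monomial r u * affine_monomial ((e, c) :: r0) u)).
  by apply: eq_bigr => u _; rewrite !consE; congr (_ * _); rewrite -mulrA mulrCA.
rewrite IH; last by rewrite /= addnS.
transitivity (\sum_u y u * (affine_monomial ((e, 0) :: linear_part r) u * affine_monomial r0 u)
   + c * \sum_u y u * affine_monomial (linear_part r ++ r0) u); last first.
  by rewrite y0 ?mulr0 ?addr0 // size_cat size_map.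
rewrite mulr_sumr -big_split; apply: eq_bigr => u _ /=.
rewrite !consE /affine_monomial big_cat /= addr0.
set A := \prod_(_ <- linear_part r) _; set B := \prod_(_ <- r0) _.
rewrite mulrDl !mulrDr; congr (_ + _); first by congr (_ * _); rewrite mulrCA mulrA.
by rewrite [RHS]mulrCA; congr (_ * _); rewrite mulrCA.
Qed.

(** In a product of [x] and [y], the inner sum over [y] of a translated monomial depends only on its
    linear part, hence not on the translation. It factors out, leaving the augmentation of [x],
    which is 0. *)
Lemma aug_power_annihilated V p a : aug_power V p a ->
  forall r, (size r < p)%N -> \sum_u a u * affine_monomial r u = 0.
Proof.
elim: p a => // p IH a [n [x [y [xI yP ->]]]] r lt_r.
under eq_bigr do rewrite sum_ffunE mulr_suml.
rewrite exchange_big big1 // => k _ /=; rewrite sum_galg_mul.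
have K := sum_linear_part (IH _ (yP k)).
under eq_bigr => v _.
  under eq_bigr do rewrite affine_monomial_shift.
  rewrite K ?size_map // linear_part_shift.
  over.
by rewrite -mulr_suml; case: (xI k) => _ ->; rewrite mul0r.
Qed.

Lemma aug_powerD V p a b : aug_power V p a -> aug_power V p b -> aug_power V p (a + b).
Proof.
case: p => [|p] /=.
  move=> sa sb v; rewrite ffunE; case: (eqVneq (a v) 0) => [->|/sa //].
  by rewrite add0r => /sb.
move=> [n [x [y [xI yP ->]]]] [m [x' [y' [xI' yP' ->]]]].
exists (n + m)%N, (fun k => match split k with inl i => x i | inr j => x' j end),
  (fun k => match split k with inl i => y i | inr j => y' j end); split.
- by move=> k; case: (split k).
- by move=> k; case: (split k).
- rewrite big_split_ord /=; congr (_ + _); apply: eq_bigr => i _.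
    by rewrite (unsplitK (inl i)).
  by rewrite (unsplitK (inr i)).
Qed.

Lemma aug_power0 V p : aug_power V p 0.
Proof.
case: p => [|p] /=; first by move=> v; rewrite ffunE eqxx.
exists 0%N, (fun=> 0), (fun=> 0); split; try by case.
by rewrite big_ord0.
Qed.

(** Allows the base tope of a flag to be changed when elements written with different base topes are
    added. *)
Lemma aug_power_shift V p u a : u \in V -> aug_power V p a ->
  aug_power V p (galg_mul (galg_basis u) a).
Proof.
move=> uV; elim: p a => [|p IH] a /=.
  move=> sa v; rewrite galg_basis_mul => /sa h.
  by rewrite -(subrK u v) memvD.
move=> [n [x [y [xI yP ->]]]]; exists n, x, (fun k => galg_mul (galg_basis u) (y k)).
split=> //; first by move=> k; apply: IH.
rewrite galg_mul_sumr; apply: eq_bigr => k _.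
by rewrite !galg_mulA (galg_mulC (x k)).
Qed.

Lemma aug_power_prod V (As : seq {set E}) :
  (forall A, A \in As -> indicator A \in V) ->
  aug_power V (size As)
    (foldr (fun A => galg_mul (galg_basis 0 + galg_basis (indicator A)))
       (galg_basis 0) As).
Proof.
elim: As => [_|A As IH AV] /=.
  by move=> v; rewrite ffunE; case: (v =P 0) => [-> _|]; rewrite ?mem0v ?eqxx.
exists 1%N, (fun=> galg_basis 0 + galg_basis (indicator A)),
  (fun=> foldr (fun A => galg_mul (galg_basis 0 + galg_basis (indicator A)))
           (galg_basis 0) As); split.
- move=> _; split.
    move=> v; rewrite !ffunE; case: (v =P 0) => [-> _|]; first exact: mem0v.
    case: (v =P _) => [-> _ _|]; first by apply: AV; rewrite inE eqxx.
    by rewrite addr0 eqxx.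
  under eq_bigr do rewrite ffunE; rewrite big_split /=.
  have one w : \sum_(v : F2vec E) galg_basis w v = 1.
    rewrite (bigD1 w) //= ffunE eqxx big1 ?addr0 // => v ne.
    by rewrite ffunE (negbTE ne).
  by rewrite !one F2_addff.
- by move=> _; apply: IH => B BA; apply: AV; rewrite inE BA orbT.
- by rewrite big_ord1.
Qed.

End GroupAlgebra.

Section TopesAsVectors.
Variables (E : finType) (M : oriented_matroid E).
Hypothesis hloopless : loopless M.
Implicit Types (X Y T U : signvec E) (u v w : F2vec E) (A : {set E}).

Lemma tope_zeros0 T : T \in topes M -> zeros T = set0.
Proof.
move=> TM; apply/eqP; rewrite -subset0 -(eqP hloopless).
by apply/subsetP=> e eT; apply/closureP=> X XM _; apply/zerosP/(subsetP (tope_zeros_sub TM XM)).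
Qed.

Lemma sv_of_inj : injective (@sv_of E).
Proof.
move=> v w /ffunP eq; apply/ffunP=> e; move: (eq e); rewrite !ffunE => -[].
by case: (F2_cases (v e)) => ->; case: (F2_cases (w e)) => ->.
Qed.

Lemma full_sv_of T : zeros T = set0 -> exists v, T = sv_of v.
Proof.
move=> T0; exists [ffun e => if T e == sneg then 1 else 0 : ('F_2)^o].
apply/ffunP=> e; rewrite !ffunE; have : e \notin zeros T by rewrite T0 inE.
by rewrite in_zeros; case: (T e) => [[]|].
Qed.

Definition to_vec (g : {ffun signvec E -> 'F_2}) : galg E := [ffun v => g (sv_of v)].

Lemma to_galgE (gamma : tope_space M 'F_2) : to_galg gamma = to_vec (extend gamma).
Proof.
apply/ffunP=> v; rewrite !ffunE big_mkcond /=; apply: eq_bigr => t _.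
by rewrite deltaE eq_sym; case: eqP; rewrite ?mulr1 ?mulr0.
Qed.

Lemma monomial_sv_of (t : seq E) v :
  monomial 'F_2 t (sv_of v) = affine_monomial [seq (e, 1) | e <- t] v.
Proof.
rewrite /monomial /affine_monomial big_map; apply: eq_bigr => e _ /=.
by rewrite ffunE; case: (F2_cases (v e)) => ->; apply/val_inj.
Qed.

Lemma annihilated_quillen p (gamma : tope_space M 'F_2) :
  quillen p gamma -> annihilated p (extend gamma).
Proof.
rewrite /quillen; case: eqP => [->|_] // [g gP ->] t lt_t.
rewrite pairing_extend; under eq_bigr do rewrite sum_ffunE mulr_suml.
rewrite exchange_big big1 // => F cF /=.
have [T [v [a [_ _ aP eqg]]]] := gP F cF.
rewrite -(pairing_extend (g F)) /pairing (big_codom_inj sv_of_inj).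
  transitivity (\sum_w galg_mul (galg_basis v) a w * affine_monomial [seq (e, 1) | e <- t] w).
    by rewrite -eqg to_galgE; apply: eq_bigr => w _; rewrite [in RHS]ffunE monomial_sv_of.
  rewrite sum_galg_mul -[RHS](mulr0 (\sum_w galg_basis v w)) mulr_suml.
  apply: eq_bigr => w _; congr (_ * _).
  under eq_bigr do rewrite affine_monomial_shift.
  by apply: (aug_power_annihilated aP); rewrite !size_map.
move=> X; case: (eqVneq (extend (g F) X) 0) => [->|/on_topes_extend/tope_zeros0 X0 _].
  by rewrite mul0r eqxx.
by have [w ->] := full_sv_of X0; exists w.
Qed.

End TopesAsVectors.

(** * Cubes as products in the group algebra *)

Section Flips.
Variable E : finType.
Implicit Types (X Y T U : signvec E) (A B : {set E}) (g : {ffun signvec E -> 'F_2}).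
Implicit Types (s : seq (E * signvec E)).

Definition flip A X : signvec E :=
  [ffun e => if e \in A then omap negb (X e) else X e].

Lemma flipK A : involutive (flip A).
Proof.
move=> X; apply/ffunP=> e; rewrite !ffunE; case: (e \in A) => //.
by case: (X e) => [[]|].
Qed.

Lemma zeros_flip A X : zeros (flip A X) = zeros X.
Proof.
by apply/setP=> e; rewrite !in_zeros ffunE; case: (e \in A) => //; case: (X e).
Qed.

Definition flip_lin A g := lin (fun X => delta 'F_2 (flip A X)) g.

Definition symmetrize A g := g + flip_lin A g.

Lemma flip_linE A g X : flip_lin A g X = g (flip A X).
Proof.
rewrite ffunE (bigD1 (flip A X)) //= deltaE flipK eqxx mulr1 big1 ?addr0 // => U ne.
rewrite deltaE; case: (X =P _) => [eq|_]; last by rewrite mulr0.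
by rewrite eq flipK eqxx in ne.
Qed.

(** The corner of the cube at which every reflection takes the sign of Y_i rather than its
    opposite. *)
Definition top s T := foldr (fun x U => sv_comp U x.2) T s.

Lemma top_drop_le s T i : sv_le (top (drop i.+1 s) T) (top (drop i s) T).
Proof.
elim: s i => [|x s IH] [|i] /=; rewrite ?sv_le_refl //.
by rewrite drop0; apply: sv_le_comp.
Qed.

(* In the order F_p, ..., F_1, where F_i is the span of the first i elements. *)
Fixpoint cube_flats s T : seq {set E} :=
  if s is x :: s' then rcons (cube_flats s' T) (zeros (top s' T)) else [::].

Lemma size_cube_flats s T : size (cube_flats s T) = size s.
Proof. by elim: s => //= x s IH; rewrite size_rcons IH. Qed.

(** The coordinates that [Y] fills in all lie in [A], so the flip acts on each of them. In [iota]
    this merely swaps the two lifts. *)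
Lemma comp_flip A U Y : zeros U \subset A ->
  sv_comp (flip A U) Y = flip A (sv_comp U (sv_opp Y)).
Proof.
move=> /subsetP UA; apply/ffunP=> e; rewrite !ffunE; move: (UA e); rewrite in_zeros.
case: (U e) => [b|] /=; first by case: (e \in A).
by move=> ->; case: (Y e) => [[]|].
Qed.

Lemma iota_symmetrize A Y g : (forall U, g U != 0 -> zeros U \subset A) ->
  iota Y (symmetrize A g) = symmetrize A (iota Y g).
Proof.
move=> gA; rewrite /symmetrize [LHS]linD; congr (_ + _).
rewrite /flip_lin /iota !lin_comp; apply: eq_lin => U /gA UA.
rewrite linB !lin_delta !F2_oppg !comp_flip // sv_oppK; exact: addrC.
Qed.

Lemma iota_foldr As Y U : (forall A, A \in As -> zeros U \subset A) ->
  iota Y (foldr symmetrize (delta 'F_2 U) As) = foldr symmetrize (iota Y (delta 'F_2 U)) As.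
Proof.
elim: As => // A As IH UA /=.
rewrite -IH; last by move=> B BA; apply: UA; rewrite inE BA orbT.
apply: iota_symmetrize => T.
have supp_zeros : forall T, foldr symmetrize (delta 'F_2 U) As T != 0 -> zeros T = zeros U.
  elim: {IH UA} As => [|B As IH] {}T /=.
    by rewrite deltaE; case: (T =P U) => [->|]; rewrite ?eqxx.
  rewrite ffunE flip_linE; case: (eqVneq (foldr symmetrize (delta 'F_2 U) As T) 0) => [->|/IH //].
  by rewrite add0r => /IH; rewrite zeros_flip.
by move/supp_zeros => ->; apply: UA; rewrite inE eqxx.
Qed.

Lemma cube_flats_sub s T A : A \in cube_flats s T -> zeros (top s T) \subset A.
Proof.
elim: s => // x s IH /=; rewrite mem_rcons inE zeros_comp => /predU1P[->|/IH].
  exact: subsetIl.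
exact: subset_trans (subsetIl _ _).
Qed.

Lemma iota_delta Y U :
  iota Y (delta 'F_2 U) = symmetrize (zeros U) (delta 'F_2 (sv_comp U Y)).
Proof.
rewrite /iota lin_delta F2_oppg /symmetrize /flip_lin lin_delta.
congr (_ + delta _ _); apply/ffunP=> e; rewrite !ffunE in_zeros.
by case: (U e).
Qed.

Lemma cube_vec_symmetrize s T :
  cube_vec 'F_2 s T = foldr symmetrize (delta 'F_2 (top s T)) (cube_flats s T).
Proof.
elim: s => //= x s IH; rewrite IH foldr_rcons -iota_delta.
by apply: iota_foldr => A; apply: cube_flats_sub.
Qed.

Lemma mem_cube_flats s T A : A \in cube_flats s T ->
  exists2 i, (0 < i <= size s)%N & A = zeros (top (drop i s) T).
Proof.
elim: s => // x s IH /=; rewrite mem_rcons inE => /predU1P[->|/IH[i /andP[_ le_i] ->]].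
  by exists 1%N => //=; rewrite drop0.
by exists i.+1.
Qed.

Lemma to_vec_symmetrize A g :
  to_vec (symmetrize A g) = galg_mul (galg_basis 0 + galg_basis (indicator A)) (to_vec g).
Proof.
rewrite galg_mulC galg_mulDr ![galg_mul (to_vec g) _]galg_mulC galg_basis0.
apply/ffunP=> v; rewrite [RHS]ffunE galg_basis_mul [LHS]ffunE [LHS]ffunE flip_linE.
rewrite [in RHS]ffunE [to_vec g (v - _)]ffunE; congr (_ + g _); apply/ffunP=> e.
rewrite !ffunE; case: (e \in A); last by rewrite subr0.
by case: (F2_cases (v e)) => ->.
Qed.

Lemma to_vec_delta (v : F2vec E) : to_vec (delta 'F_2 (sv_of v)) = galg_basis v.
Proof. by apply/ffunP=> w; rewrite !ffunE (inj_eq (@sv_of_inj _)). Qed.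

Lemma to_vec_cube s T (v : F2vec E) : top s T = sv_of v ->
  to_vec (cube_vec 'F_2 s T) = galg_mul (galg_basis v)
    (foldr (fun A => galg_mul (galg_basis 0 + galg_basis (indicator A)))
       (galg_basis 0) (cube_flats s T)).
Proof.
rewrite cube_vec_symmetrize => ->; elim: (cube_flats s T) => [|A As IH] /=.
  by rewrite to_vec_delta galg_basisD addr0.
by rewrite to_vec_symmetrize IH !galg_mulA (galg_mulC (_ + _)).
Qed.

End Flips.

(** * Complete flags and their topes *)

Section Flags.
Variables (E : finType) (M : oriented_matroid E).
Hypothesis hloopless : loopless M.
Implicit Types (X Y T U L K : signvec E) (A B : {set E}) (v w : F2vec E).
Implicit Types (s : seq (E * signvec E)) (F : flag M) (gamma : tope_space M 'F_2).
Let d := rank M [set: E].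

Lemma zeros_tope (T : tope M) : zeros (val T) = set0.
Proof. by have := tope_zeros0 hloopless (valP T). Qed.

Lemma zeros_sv0 : zeros (sv0 E) = [set: E].
Proof. by apply/setP=> e; rewrite in_zeros ffunE inE. Qed.

Lemma rank_sv0 : rank M (zeros (sv0 E)) = d.
Proof. by rewrite zeros_sv0. Qed.

Lemma rank_eq_d K : K \in covectors M -> rank M (zeros K) = d -> K = sv0 E.
Proof.
move=> KM rK; apply/eqP/negPn/negP=> ne.
have := rank_lt (covectors0 M) KM (sv0_le K); rewrite eq_sym ne rK rank_sv0 ltnn.
by move/(_ isT).
Qed.

Lemma rank_lt_d K : K \in covectors M -> K != sv0 E -> (rank M (zeros K) < d)%N.
Proof. by move=> KM ne; rewrite -rank_sv0 rank_lt ?covectors0 ?sv0_le // eq_sym. Qed.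

Definition lower K := odflt K [pick L | (L \in covectors M) && sv_le L K &&
  (rank M (zeros L) == (rank M (zeros K)).+1)].

Lemma lowerP K : K \in covectors M -> (rank M (zeros K) < d)%N ->
  [/\ lower K \in covectors M, sv_le (lower K) K
    & rank M (zeros (lower K)) = (rank M (zeros K)).+1].
Proof.
move=> KM lt; have K0 : K != sv0 E by apply: contraTneq lt => ->; rewrite rank_sv0 ltnn.
rewrite /lower; case: pickP => [L /andP[/andP[LM LK] /eqP rL] //|none].
have [L [LM LK rL]] := lower_cover KM K0.
by have := none L; rewrite LM LK rL eqxx.
Qed.

Lemma iter_lower K i : K \in covectors M -> (rank M (zeros K) + i <= d)%N ->
  iter i lower K \in covectors M /\ rank M (zeros (iter i lower K)) = (rank M (zeros K) + i)%N.
Proof.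
move=> KM; elim: i => [|i IH] le; first by rewrite addn0.
rewrite addnS in le; have [LM rL] := IH (ltnW le).
have [] := lowerP LM; first by rewrite rL.
by rewrite /= rL addnS.
Qed.

(** Stated for any [N] since the induction passes to contractions; each contraction undone adds one
    to the rank. *)
Lemma cube_chain N s T : cube N s T -> forall i, (i <= size s)%N ->
  top (drop i s) T \in covectors N /\ rank N (zeros (top (drop i s) T)) = i.
Proof.
elim: s N => [|[e Y] s IH] N /=.
  by move=> TN [|i] // _; rewrite rank_tope // tope_cov.
case/and3P=> YN Ye sT [_|i] /=; last first.
  rewrite ltnS => /(IH _ sT)[UN rU]; rewrite (ctr_sub UN); split=> //.
  by rewrite (rank_contract_zeros YN Ye) ?rU // (ctr_zero UN).
have [] := IH _ sT 0%N isT; rewrite drop0 => UN rU.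
have /= UT := rank0_tope (M := contract N e) UN rU.
have UYT := comp_contract_tope YN Ye UT.
by rewrite tope_cov // rank_tope.
Qed.

Section CompleteFlag.
Variable F : flag M.
Hypothesis cF : complete_flag F.

Lemma flag0 : F ord0 = set0.
Proof. by case/and5P: cF => /eqP. Qed.

Lemma flag_max : F ord_max = [set: E].
Proof. by case/and5P: cF => _ /eqP. Qed.

Lemma flag_cov i : exists2 L, L \in covectors M & F i = zeros L.
Proof. by apply/flatP; case/and5P: cF => _ _ /forallP. Qed.

Lemma flag_rank i : rank M (F i) = i.
Proof. by apply/eqP; case/and5P: cF => _ _ _ /forallP. Qed.

Lemma flag_sub (i j : 'I_d.+1) : (i <= j)%N -> F i \subset F j.
Proof.
rewrite leq_eqVlt => /predU1P[/val_inj-> //|lt].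
by case/and5P: cF => _ _ _ _ /forallP/(_ i)/forallP/(_ j)/implyP/(_ lt)/proper_sub.
Qed.

Lemma zeros_sv_del T A : zeros T = set0 -> zeros (sv_del T A) = A.
Proof.
move=> /setP T0; apply/setP=> e; rewrite in_zeros ffunE; case: ifP => // _.
by have := T0 e; rewrite in_zeros inE.
Qed.

(** Even a flag contributing 0 to a Quillen sum must exhibit a base tope. It is built from the top
    flat downwards, composing at each step with a covector of the next smaller flat. *)
Lemma flag_tope_exists : exists T : tope M, flag_tope F T.
Proof.
suff gen k : (k <= d)%N -> exists X, [/\ X \in covectors M,
    zeros X = F (inord (d - k)) & forall j : 'I_d.+1, (d - k <= j)%N ->
      sv_del X (F j) \in covectors M].
  have [X [XM X0 Xj]] := gen d (leqnn d).
  have XT : X \in topes M.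
    apply: tope_zerosP => // Y _; rewrite X0 subnn -[inord 0]/(inord (@ord0 d)).
    by rewrite inord_val flag0 sub0set.
  exists (exist (fun X => X \in topes M) X XT); apply/forallP=> j /=.
  by apply: Xj; rewrite subnn.
elim: k => [|k IH] le_k.
  have [L LM eL] := flag_cov (inord (d - 0)); exists L; split=> // j.
  rewrite subn0 => le_j; have -> : sv_del L (F j) = sv0 E.
    have -> : j = ord_max by apply/val_inj/anti_leq; rewrite le_j -ltnS ltn_ord.
    by rewrite flag_max; apply/ffunP=> e; rewrite !ffunE inE.
  exact: covectors0.
have [X [XM X0 Xj]] := IH (ltnW le_k).
have [W WM eW] := flag_cov (inord (d - k.+1)).
have XW : zeros (sv_comp X W) = F (inord (d - k.+1)).
  rewrite zeros_comp X0 -eW; apply/setIidPr/flag_sub.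
  by rewrite !inordK ?ltnS ?leq_subr // leq_sub2l.
exists (sv_comp X W); split=> //; first exact: covectorsC.
move=> j; rewrite leq_eqVlt => /predU1P[eq_j|lt_j].
  have -> : sv_del (sv_comp X W) (F j) = sv_comp X W; last exact: covectorsC.
  apply/ffunP=> e; rewrite ffunE; case: ifP => // ej; apply/esym/zerosP.
  by rewrite XW eq_j inord_val.
have le_j : (d - k <= j)%N by rewrite -subSn // subSS in lt_j *.
have -> : sv_del (sv_comp X W) (F j) = sv_del X (F j); last exact: Xj.
apply/ffunP=> e; rewrite !ffunE; case: ifP => // ej; case: ifP => // /negbFE/eqP/zerosP.
rewrite X0 => eX; have := subsetP (@flag_sub (inord (d - k)) j _) _ eX.
by rewrite ej inordK ?ltnS ?leq_subr // => /(_ le_j).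
Qed.

(* On F_(k+1) minus F_k two topes of the flag agree or are opposite. *)
Lemma flag_tope_dir (T T' : tope M) v v' : flag_tope F T -> flag_tope F T' ->
  val T = sv_of v -> val T' = sv_of v' -> v' - v \in flag_space F.
Proof.
move=> /forallP FT /forallP FT' eT eT'.
have T0 := zeros_tope T.
have T0' := zeros_tope T'.
(* The difference truncated to F_k, to be assembled one layer of the flag at a time. *)
pose w k : F2vec E := [ffun e => if e \in F (inord k) then (v' - v) e else 0].
have memF i : indicator (F i) \in flag_space F.
  by apply: memv_span; apply: map_f; rewrite mem_enum.
suff gen k : (k <= d)%N -> w k \in flag_space F.
  have -> : v' - v = w d; last exact: gen.
  apply/ffunP=> e; rewrite [RHS]ffunE -[inord d]/(inord (@ord_max d)) inord_val.
  by rewrite flag_max inE.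
elim: k => [_|k IH lt_k].
  have -> : w 0%N = 0; last exact: mem0v.
  apply/ffunP=> e; rewrite [LHS]ffunE -[inord 0]/(inord (@ord0 d)) inord_val flag0.
  by rewrite inE ffunE.
set i : 'I_d.+1 := inord k; set j : 'I_d.+1 := inord k.+1.
have vi : i = k :> nat by rewrite inordK // ltnS ltnW.
have vj : j = k.+1 :> nat by rewrite inordK // ltnS.
have sub_ij : F i \subset F j by apply: flag_sub; rewrite vi vj.
have agree g h : g \in F j -> g \notin F i -> h \in F j -> h \notin F i ->
    val T g = val T' g -> val T h = val T' h.
  move=> gj gi hj hi eqg; apply/eqP/negPn/negP=> neh.
  have nzT e : val T e != szero by rewrite -in_zeros T0 inE.
  have nzT' e : val T' e != szero by rewrite -in_zeros T0' inE.
  have delE (S : tope M) e : e \notin F i -> sv_del (val S) (F i) e = val S e.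
    by move=> /negbTE ei; rewrite ffunE ei.
  have del0 (S : tope M) e : e \in F i -> sv_del (val S) (F i) e = szero.
    by move=> ei; rewrite ffunE ei.
  have [|||Z [ZM Zh Z0 _ Zs]] := eliminate (e := h) (FT i) (FT' i).
  - by rewrite delE.
  - by rewrite delE.
  - by rewrite !delE.
  have Zg : Z g != szero by rewrite Zs !delE.
  have [L LM eL] := flag_cov j.
  have rL : rank M (zeros L) = k.+1 by rewrite -eL flag_rank.
  have LZM := covectorsC LM ZM.
  have lt1 : (rank M (zeros (sv_comp L Z)) < rank M (zeros L))%N.
    apply: rank_zeros_lt => //; rewrite zeros_comp properE subsetIl /=.
    by apply/subsetPn; exists g; rewrite ?in_setI -eL gj // in_zeros.
  have zT : zeros (sv_del (val T) (F i)) = F i by apply: zeros_sv_del.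
  have lt2 : (rank M (zeros (sv_del (val T) (F i))) < rank M (zeros (sv_comp L Z)))%N.
    apply: rank_zeros_lt => //.
    rewrite zT zeros_comp -eL; apply/properP; split.
      rewrite subsetI sub_ij; apply/subsetP=> e ei; apply/zerosP.
      by rewrite Z0 del0.
    by exists h => //; rewrite in_setI hj; apply/zerosP.
  rewrite rL ltnS in lt1; rewrite zT flag_rank vi in lt2.
  by have := leq_trans lt2 lt1; rewrite ltnn.
have sv_agree e : (val T e == val T' e) = ((v' - v) e == 0).
  rewrite eT eT' !ffunE subr_eq0.
  by case: (F2_cases (v e)) => ->; case: (F2_cases (v' e)) => ->.
have [g gP] : exists g, (g \in F j) && (g \notin F i).
  have : ~~ (F j \subset F i).
    by apply/negP=> h; have := flag_rank j; rewrite (_ : F j = F i) ?flag_rank ?vi ?vj;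
      [apply: n_Sn | apply/eqP; rewrite eqEsubset h].
  by case/subsetPn=> g gj gi; exists g; rewrite gj.
case/andP: gP => gj gi.
have -> : w k.+1 = w k + (v' - v) g *: (indicator (F j) - indicator (F i)); last first.
  by rewrite memvD ?IH ?(ltnW lt_k) // memvZ // memvB.
apply/ffunP=> e; rewrite !ffunE -/i -/j.
case: (boolP (e \in F i)) => ei /=.
  by rewrite (subsetP sub_ij _ ei) subrr scaler0 addr0.
case: (boolP (e \in F j)) => ej /=; last by rewrite subrr scaler0 addr0.
have E1 : ((v' - v) e == 0) = ((v' - v) g == 0).
  by rewrite -!sv_agree; apply/eqP/eqP; apply: agree.
rewrite subr0 add0r -[_ *: _]/((v' g - v g : 'F_2) * 1) mulr1.
move: E1; rewrite !ffunE.
by case: (F2_cases (v' e - v e)) => ->; case: (F2_cases (v' g - v g)) => ->.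
Qed.

Lemma flag_powerD p gamma gamma' : flag_power F p gamma -> flag_power F p gamma' ->
  flag_power F p (gamma + gamma').
Proof.
move=> [T [v [a [FT eT aP eqg]]]] [T' [v' [a' [FT' eT' aP' eqg']]]].
exists T, v, (a + galg_mul (galg_basis (v' - v)) a'); split=> //.
  by apply: aug_powerD aP (aug_power_shift _ aP'); apply: flag_tope_dir FT FT' eT eT'.
rewrite galg_mulDr galg_mulA galg_basisD [v + _]addrC subrK -eqg -eqg'.
apply/ffunP=> u; rewrite !ffunE -big_split.
by apply: eq_bigr => S _; rewrite ffunE.
Qed.

Lemma flag_power0 p : flag_power F p 0.
Proof.
have [T FT] := flag_tope_exists.
have [v eT] : exists v, val T = sv_of v.
  by apply: full_sv_of; apply: zeros_tope.
exists T, v, 0; split=> //; first exact: aug_power0.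
rewrite galg_mulr0; apply/ffunP=> u; rewrite !ffunE big1 // => S _.
by rewrite ffunE.
Qed.

End CompleteFlag.

Lemma quillenD p gamma gamma' : quillen p gamma -> quillen p gamma' ->
  quillen p (gamma + gamma').
Proof.
rewrite /quillen; case: eqP => // _ [g gP ->] [g' gP' ->].
exists (fun F => g F + g' F); last by rewrite big_split.
by move=> F cF; apply: flag_powerD; auto.
Qed.

Lemma quillen0 p : quillen p (0 : tope_space M 'F_2).
Proof.
rewrite /quillen; case: eqP => // _; exists (fun=> 0); last by rewrite big1.
by move=> F cF; apply: flag_power0.
Qed.

Lemma quillen_flag p F gamma : complete_flag F -> flag_power F p gamma -> quillen p gamma.
Proof.
move=> cF Fg; rewrite /quillen; case: eqP => // _.
exists (fun F' => if F' == F then gamma else 0).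
  by move=> F' cF'; case: eqP => [->|_] //; apply: flag_power0.
by rewrite -big_mkcondr (big_pred1 F) // => F' /=; case: eqP => [->|]; rewrite ?cF ?andbF.
Qed.

Lemma quillen_cube s T gamma : cube M s T -> extend gamma = cube_vec 'F_2 s T ->
  quillen (size s) gamma.
Proof.
move=> sT eg; set p := size s.
have chain := cube_chain sT.
have [TM rT] := chain p (leqnn p); rewrite /p drop_size /= -/p in TM rT.
have le_p : (p <= d)%N.
  case: (eqVneq T (sv0 E)) => [T0|/(rank_lt_d TM)]; first by rewrite -rT T0 rank_sv0.
  by rewrite rT => /ltnW.
(* The cube supplies covectors only up to rank p; beyond that, lower covers of [T] complete the
   chain down to the zero covector, of rank d. *)
pose Ls i := if (i <= p)%N then top (drop i s) T else iter (i - p) lower T.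
have LsP i : (i <= d)%N -> Ls i \in covectors M /\ rank M (zeros (Ls i)) = i.
  move=> le_i; rewrite /Ls; case: leqP => [/chain //|lt_i].
  have := @iter_lower T (i - p) TM; rewrite rT subnKC; last exact: ltnW.
  by move/(_ le_i).
have LsS i : (i < d)%N -> sv_le (Ls i.+1) (Ls i).
  move=> lt_i; case: (ltnP i p) => [lt_ip|le_pi].
    by rewrite /Ls lt_ip (ltnW lt_ip); apply: top_drop_le.
  have [LM rL] := LsP i (ltnW lt_i).
  have eL : Ls i = iter (i - p) lower T.
    rewrite /Ls; case: ltngtP le_pi => // eq _.
    by rewrite -eq subnn /p drop_size.
  have -> : Ls i.+1 = lower (Ls i) by rewrite eL /Ls ltnNge le_pi /= subSn.
  by have [] := lowerP LM; rewrite ?rL.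
have LsW i j : (i <= j)%N -> (j <= d)%N -> sv_le (Ls j) (Ls i).
  move=> le_ij; elim: j le_ij => [|j IH]; first by rewrite leqn0 => /eqP-> _; apply: sv_le_refl.
  rewrite leq_eqVlt => /predU1P[-> _|lt_ij lt_j]; first exact: sv_le_refl.
  by apply: sv_le_trans (LsS j lt_j) _; apply: IH => //; apply: ltnW.
pose F : flag M := [ffun i : 'I_d.+1 => zeros (Ls i)].
have T0M : Ls 0%N \in topes M.
  by have [LM rL] := LsP 0%N isT; apply: rank0_tope.
have cF : complete_flag F.
  have FE i : F i = zeros (Ls i) by rewrite ffunE.
  have le_d (i : 'I_d.+1) : (i <= d)%N by rewrite -ltnS.
  apply/and5P; split.
  - by rewrite FE (tope_zeros0 hloopless T0M).
  - have [LM rL] := LsP d (leqnn d).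
    by rewrite FE /= (rank_eq_d LM rL) zeros_sv0.
  - by apply/forallP=> i; rewrite FE; apply: flat_zeros; case: (LsP i (le_d i)).
  - by apply/forallP=> i; rewrite FE; case: (LsP i (le_d i)) => _ ->.
  - apply/forallP=> i; apply/forallP=> j; apply/implyP=> lt_ij; rewrite !FE.
    apply: le_zeros_proper; first by apply: LsW (ltnW lt_ij) (le_d j).
    apply: contraTneq lt_ij => eq; have := (LsP i (le_d i)).2.
    by rewrite -eq (LsP j (le_d j)).2 => ->; rewrite ltnn.
apply: (quillen_flag cF).
have [v eT] := full_sv_of (tope_zeros0 hloopless T0M).
pose T0 : tope M := exist (fun X => X \in topes M) (Ls 0%N) T0M.
exists T0, v, (foldr (fun A => galg_mul (galg_basis 0 + galg_basis (indicator A)))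
       (galg_basis 0) (cube_flats s T)); split=> //.
- apply/forallP=> i; rewrite ffunE /=.
  have le_i : (i <= d)%N by rewrite -ltnS.
  have [LM _] := LsP i le_i.
  suff -> : sv_del (Ls 0%N) (zeros (Ls i)) = Ls i by [].
  apply/ffunP=> e; rewrite ffunE; case: ifP => [/zerosP-> //|/negbT].
  by rewrite in_zeros => /(sv_leP _ _ (LsW 0%N i isT le_i)).
- rewrite -[p](size_cube_flats s T); apply: aug_power_prod => A /mem_cube_flats[i].
  case/andP=> i0 le_i ->; have lt_i : (i < d.+1)%N by rewrite ltnS (leq_trans le_i).
  apply: memv_span; apply/mapP; exists (Ordinal lt_i); first by rewrite mem_enum.
  by rewrite ffunE /Ls /= le_i.
- rewrite to_galgE eg; apply: to_vec_cube.
  by rewrite -eT /Ls leq0n drop0.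
Qed.

Lemma quillen_span p gamma : cube_span M p (extend gamma) -> quillen p gamma.
Proof.
case=> l lC eg; pose gam (x : seq (E * signvec E) * signvec E) : tope_space M 'F_2 :=
  [ffun t => cube_vec 'F_2 x.1 x.2 (val t)].
have -> : gamma = \sum_(x <- l) gam x.
  apply/ffunP=> t; rewrite -extend_val eg !sum_ffunE.
  by apply: eq_bigr => x _; rewrite ffunE.
elim: l lC {eg} => [|x l IH] /=; first by rewrite big_nil => _; apply: quillen0.
case/andP=> /andP[/eqP sz xC] lC; rewrite big_cons.
apply: quillenD; last exact: IH.
rewrite -sz; apply: (quillen_cube xC); apply/ffunP=> X.
case: (boolP (X \in topes M)) => XT.
  by rewrite (extend_val (gam x) (exist (fun X => X \in topes M) X XT)) ffunE.
have -> : extend (gam x) X = 0.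
  by apply/eqP; apply: contraNT XT; apply: on_topes_extend.
by apply/esym/eqP; apply: contraNT XT; apply: (on_topes_cube xC).
Qed.

End Flags.

(** * Integral lifts *)

Section DualVarchenkoGelfand.
Variables (E : finType) (M : oriented_matroid E).
Implicit Types (s : seq E) (T : tope M) (g : tope_space M int).

Lemma heaviside_basis e T : heaviside e (tope_basis T) = (val T e == spos)%:R.
Proof.
rewrite /heaviside (bigD1 T) //= ffunE eqxx mul1r big1 ?addr0 // => T' ne.
by rewrite ffunE (negbTE ne) mul0r.
Qed.

Lemma tope_basis_sum g : g = \sum_T tope_basis T *~ g T.
Proof.
apply/ffunP=> T; rewrite sum_ffunE (bigD1 T) //=.
have E1 (T' : tope M) : (tope_basis T' *~ g T') T = g T' * (T == T')%:R.
  transitivity (tope_basis T' T *~ g T').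
    by case: (g T') => n; rewrite ?NegzE ?mulrNz ?[in LHS]ffunE -!pmulrn ffunMnE.
  by rewrite ffunE -mulrzl intz.
rewrite E1 eqxx mulr1 big1 ?addr0 // => T' ne.
by rewrite E1 eq_sym (negbTE ne) mulr0.
Qed.

Lemma additive_basis (f : {additive tope_space M int -> int}) g :
  f g = \sum_T g T * f (tope_basis T).
Proof.
rewrite {1}(tope_basis_sum g) raddf_sum; apply: eq_bigr => T _.
by rewrite raddfMz -mulrzl intz.
Qed.

Definition seq_of_mnm (m : 'X_{1..#|E|}) : seq E :=
  flatten [seq nseq (m i) (enum_val i) | i <- enum 'I_#|E|].

Lemma size_seq_of_mnm m : size (seq_of_mnm m) = mdeg m.
Proof.
rewrite size_flatten /shape -map_comp mdegE sumnE big_map big_enum.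
by apply: eq_bigr => i _ /=; rewrite size_nseq.
Qed.

Lemma monomial_seq_of_mnm m T :
  monomial int (seq_of_mnm m) (val T) =
  \prod_i (heaviside (enum_val i) (tope_basis T)) ^+ m i.
Proof.
rewrite /monomial big_flatten big_map big_enum; apply: eq_bigr => i _ /=.
by rewrite heaviside_basis big_nseq iter_mulr_1.
Qed.

(** An additive form is determined by its values on topes, so a representing polynomial can be
    tested monomial by monomial; [msize] at most p means degree below p. *)
Lemma dual_vg_annihilated p g : annihilated p (extend g) -> dual_vg p g.
Proof.
move=> gA f [q le_q qf]; rewrite additive_basis.
under eq_bigr => T _ do rewrite qf mevalE mulr_sumr.
rewrite exchange_big big_seq big1 // => m mq /=.
transitivity (q@_m * pairing (monomial int (seq_of_mnm m)) (extend g)); last first.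
  rewrite gA ?mulr0 // size_seq_of_mnm; exact: leq_trans (msize_mdeg_lt mq) le_q.
rewrite pairing_extend mulr_sumr; apply: eq_bigr => T _.
by rewrite mulrCA monomial_seq_of_mnm.
Qed.

Definition monomial_form s g : int := pairing (monomial int s) (extend g).

Lemma monomial_form_is_additive s : zmod_morphism (monomial_form s).
Proof.
move=> g h; rewrite /monomial_form !pairing_extend -sumrB.
by apply: eq_bigr => T _; rewrite !ffunE mulrBl.
Qed.

HB.instance Definition _ s :=
  GRing.isZmodMorphism.Build (tope_space M int) int (monomial_form s)
    (monomial_form_is_additive s).

Definition mnm_of_seq s : 'X_{1..#|E|} := (\sum_(e <- s) U_(enum_rank e))%MM.

Lemma mdeg_mnm_of_seq s : mdeg (mnm_of_seq s) = size s.
Proof.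
elim: s => [|e s IH]; rewrite /mnm_of_seq ?big_nil ?mdeg0 // big_cons.
by rewrite mdegD mdeg1 -/(mnm_of_seq s) IH.
Qed.

Lemma monomial_form_represents s : represents 'X_[mnm_of_seq s]
  (monomial_form s : {additive tope_space M int -> int}).
Proof.
move=> T /=.
have -> : monomial_form s (tope_basis T) = monomial int s (val T).
  rewrite /monomial_form pairing_extend (bigD1 T) //= ffunE eqxx mul1r big1 ?addr0 //.
  by move=> T' ne; rewrite ffunE (negbTE ne) mul0r.
elim: s => [|e s IH]; rewrite /monomial /mnm_of_seq ?big_nil ?big_cons.
  by rewrite mpolyX0 meval1.
rewrite mpolyXD mevalM mevalXU enum_rankK heaviside_basis; congr (_ * _); exact: IH.
Qed.

Lemma annihilated_dual_vg p g : dual_vg p g -> annihilated p (extend g).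
Proof.
move=> gP s lt_s; apply: (gP (monomial_form s : {additive tope_space M int -> int})).
exists 'X_[mnm_of_seq s]; last exact: monomial_form_represents.
by rewrite msizeX mdeg_mnm_of_seq.
Qed.

Lemma intr_monomial s X : (monomial int s X)%:~R = monomial 'F_2 s X.
Proof. by rewrite rmorph_prod; apply: eq_bigr => e _; rewrite rmorph_nat. Qed.

Lemma annihilated_dual_vg_mod2 p (gamma : tope_space M 'F_2) :
  dual_vg_mod2 p gamma -> annihilated p (extend gamma).
Proof.
case=> g gP -> s lt_s; have := annihilated_dual_vg gP lt_s.
rewrite !pairing_extend => /(congr1 (fun z : int => z%:~R : 'F_2)).
rewrite rmorph_sum /= => eq0; rewrite -[RHS]eq0; apply: eq_bigr => T _.
by rewrite ffunE rmorphM /= intr_monomial.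
Qed.

Lemma intr_cube_vec (s : seq (E * signvec E)) U X :
  (cube_vec int s U X)%:~R = cube_vec 'F_2 s U X.
Proof.
elim: s X => [|x s IH] X /=; first by rewrite !deltaE rmorph_nat.
rewrite !ffunE rmorph_sum; apply: eq_bigr => Z _ /=.
by rewrite rmorphM /= IH !ffunE rmorphB /= !rmorph_nat.
Qed.

(** The alternating integral cubes supply the lift: they reduce to the mod 2 cubes and already
    satisfy the integral degree conditions. *)
Lemma dual_vg_mod2_span p (gamma : tope_space M 'F_2) :
  cube_span M p (extend gamma) -> dual_vg_mod2 p gamma.
Proof.
case=> l lC eg; pose G := \sum_(x <- l) cube_vec int x.1 x.2.
pose g : tope_space M int := [ffun T => G (val T)].
have cubeP x : x \in l -> cube M x.1 x.2 /\ size x.1 = p.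
  by move=> /(allP lC)/andP[/eqP].
have GT : on_topes M G.
  move=> T; rewrite /G big_seq; elim/big_rec: _ => [|x y /cubeP[xC _] IH].
    by rewrite ffunE eqxx.
  rewrite ffunE; case: (eqVneq (cube_vec int x.1 x.2 T) 0) => [->|h _].
    by rewrite add0r.
  exact: (on_topes_cube xC h).
exists g; last first.
  apply/ffunP=> T; rewrite [RHS]ffunE [g T]ffunE -extend_val eg !sum_ffunE rmorph_sum.
  by apply: eq_bigr => x _; apply/esym/intr_cube_vec.
apply: dual_vg_annihilated => s lt_s.
rewrite pairing_extend; transitivity (pairing (monomial int s) G).
  rewrite /pairing (big_codom_inj (@val_inj _ _ (tope M))).
    by apply: eq_bigr => T _; rewrite ffunE.
  move=> X; case: (eqVneq (G X) 0) => [->|/GT XT _]; first by rewrite mul0r eqxx.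
  by exists (exist (fun X => X \in topes M) X XT).
rewrite pairing_sum big_seq big1 // => x /cubeP[xC sz].
by apply: (annihilated_cube _ xC); rewrite sz.
Qed.

End DualVarchenkoGelfand.

Theorem theorem1 (E : finType) (M : oriented_matroid E) (d : nat)
    (hloopless : loopless M) (hrank : rank M [set: E] = d)
    (p : nat) (hp : (p <= d)%N) :
  (forall gamma : tope_space M 'F_2, quillen p gamma <-> kalinin p gamma) /\
  (forall gamma : tope_space M 'F_2, kalinin p gamma <-> dual_vg_mod2 p gamma).
Proof.
have span (gamma : tope_space M 'F_2) :
    annihilated p (extend gamma) -> cube_span M p (extend gamma).
  exact: annihilated_span (@on_topes_extend _ M _ gamma).
split=> gamma; split.
- move/(annihilated_quillen hloopless)/span => /raw_kalinin_span; exact: kalinin_of_raw.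
- by move/annihilated_kalinin/span; apply: quillen_span.
- by move/annihilated_kalinin/span; apply: dual_vg_mod2_span.
- move/annihilated_dual_vg_mod2/span => /raw_kalinin_span; exact: kalinin_of_raw.
Qed.
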